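(* Let $X,U,V$ be Banach spaces, let $A:D(A)\subset X\to X$ generate a $C_0$-semigroup $T=(T(t))_{t\ge 0}$ on $X$, let $B\in L(U,X_{-1})$, $B_2\in L(V,X_{-1})$ and $f:X\times U\to V$. Assume: (a) $B$ is $\infty$-admissible for $T$, and the map $(t,u)\mapsto \Phi(t)u:=\int_0^tT_{-1}(t-s)Bu(s)\,ds$ is continuous from $\mathbb{R}_+\times L^\infty(\mathbb{R}_+,U)$ to $X$; (b) $B_2$ is zero-class $\infty$-admissible for $T$, and for all $u\in L^\infty(\mathbb{R}_+,U)$ and all $x\in C(\mathbb{R}_+,X)$ the map $s\mapsto f(x(s),u(s))$ is in $L^\infty_{loc}(\mathbb{R}_+,V)$; (c) for every $C>0$ there is $L(C)>0$ with $\|f(y,v)-f(x,v)\|_V\le L(C)\|y-x\|_X$ for all $x,y\in X$ with $\|x\|_X,\|y\|_X<C$ and all $v\in U$ with $\|v\|_U<C$; $f(x,\cdot)$ is continuous for every $x\in X$; and there are $\sigma\in\mathcal{K}_\infty$, $c>0$ with $\|f(0,u)\|_V\le\sigma(\|u\|_U)+c$ for all $u\in U$. Let $M\ge 1$, $\lambda>0$ be such that $\|T(t)\|\le Me^{\lambda t}$ for all $t\ge0$. Let $h_t$, $t>0$, be admissibility constants of $B$ (nondecreasing in $t$), and $h_0:=\lim_{t\to+0}h_t$. Then for any compact set $Q\subset X$, any $r>0$, any bounded set $\mathcal{S}\subset U$, and any $\delta>0$ there is a time $t_1=t_1(Q,r,\mathcal{S},\delta)>0$ such that for any $w\in Q$,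 any $x_0\in B_r(w)$, and any $u\in L^\infty(\mathbb{R}_+,U)$ with $u(t)\in\mathcal{S}$ for a.e. $t\in\mathbb{R}_+$, there is a unique mild solution $\phi(\cdot,x_0,u)$ on $[0,t_1]$ of $$\dot x(t)=Ax(t)+B_2f(x(t),u(t))+Bu(t),\qquad x(0)=x_0,$$ and $\phi([0,t_1],x_0,u)\subset B_{Mr+h_0\|u\|_{L^\infty([0,t_1],U)}+\delta}(w)$.
   Context: $B_\rho(w)$ is the open ball in $X$ of radius $\rho$ around $w$. $\mathcal{K}_\infty$ is the set of continuous, strictly increasing, unbounded $\gamma:\mathbb{R}_+\to\mathbb{R}_+$ with $\gamma(0)=0$. $X_{-1}$ is the completion of $X$ in the norm $x\mapsto\|(aI-A)^{-1}x\|_X$ with some $a\in\rho(A)$ (different $a$ give equivalent norms); $T$ extends uniquely to a $C_0$-semigroup $T_{-1}=(T_{-1}(t))_{t\ge0}$ on $X_{-1}$. $L^\infty_{loc}(\mathbb{R}_+,Y)$: strongly measurable functions $\mathbb{R}_+\to Y$ that are essentially bounded on every $[0,t]$. An operator $B\in L(U,X_{-1})$ is $\infty$-admissible for $T$ if there is $t>0$ such that $\int_0^tT_{-1}(t-s)Bu(s)\,ds\in X$ for all $u\in L^\infty_{loc}(\mathbb{R}_+,U)$. Equivalently (known fact), for every $t>0$ there is $h_t>0$ such that for all $u\in L^\infty_{loc}(\mathbb{R}_+,U)$ this integral lies in $X$ and $\|\int_0^tT_{-1}(t-s)Bu(s)\,ds\|_X\le h_t\|u\|_{L^\infty([0,t],U)}$;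 $t\mapsto h_t$ is assumed (without loss of generality) nondecreasing. These $h_t$ are the admissibility constants. $B$ is zero-class $\infty$-admissible if the constants can be chosen with $\lim_{t\to+0}h_t=0$. The same definitions apply to $B_2$ with $V$ in place of $U$. A mild solution on $[0,\tau]$ is a function $x\in C([0,\tau],X)$ such that for all $t\in[0,\tau]$ $$x(t)=T(t)x_0+\int_0^tT_{-1}(t-s)B_2f(x(s),u(s))\,ds+\int_0^tT_{-1}(t-s)Bu(s)\,ds,$$ with Bochner integrals of $X_{-1}$-valued maps. *)

(* Defs.v *)
From HB Require Import structures.
From mathcomp Require Import all_boot all_order all_algebra.
From mathcomp Require Import all_classical all_reals all_analysis.
From mathcomp Require Import ess_sup_inf.
Set Implicit Arguments.
Unset Strict Implicit.
Unset Printing Implicit Defensive.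
Import Order.TTheory GRing.Theory Num.Theory.
Import numFieldNormedType.Exports.
Local Open Scope classical_set_scope.
Local Open Scope ring_scope.

                                                                              
                                                                                
                                                          

Definition class_Kinfty (R : realType) (g : R -> R) : Prop :=
  [/\ {within `[0, +oo[, continuous g}, g 0 = 0,
      forall s t, 0 <= s -> s < t -> g s < g t &
      forall M, exists2 t, 0 <= t & M < g t].

Section integration.
Context {R : realType} {E : normedModType R}.
Implicit Types (D : set R) (g : R -> E) (y : E).

Notation mu := (@lebesgue_measure R).

Definition simple_fun g : Prop :=
  finite_set (range g) /\ forall v, measurable (g @^-1` [set v]).

Definition ae_limit D (gn : (R -> E)^nat) g : Prop :=
  {ae mu, forall s, D s -> gn n s @[n --> \oo] --> g s}.

Definition strongly_measurable D g : Prop :=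
  exists gn : (R -> E)^nat, (forall n, simple_fun (gn n)) /\ ae_limit D gn g.

Definition simple_integrable D g : Prop :=
  simple_fun g /\
  forall v, v != 0 -> (mu (D `&` g @^-1` [set v]) < +oo)%E.

                                                                               
                                                      
Definition simple_integral D g : E :=
  \sum_(v \in range g) fine (mu (D `&` g @^-1` [set v])) *: v.

                                                     
Definition is_Bochner_integral D g y : Prop :=
  exists gn : (R -> E)^nat,
    [/\ forall n, simple_integrable D (gn n),
        ae_limit D gn g,
        (\int[mu]_(s in D) (`|g s - gn n s|)%:E)%E @[n --> \oo] --> 0%E &
        simple_integral D (gn n) @[n --> \oo] --> y].

Definition ess_bounded D g : Prop :=
  exists M : R, {ae mu, forall s, D s -> `|g s| <= M}.

Definition Linfty g : Prop :=
  strongly_measurable `[0, +oo[ g /\ ess_bounded `[0, +oo[ g.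

Definition Linfty_loc g : Prop :=
  strongly_measurable `[0, +oo[ g /\
  forall t, 0 <= t -> ess_bounded `[0, t] g.

                                                                               
Definition Linfty_norm D g : R :=
  fine (ess_sup mu ((fun s => (`|g s|)%:E) \_ D)).

End integration.

Section semigroups.
Context {R : realType}.

Definition op_norm {E F : normedModType R} (S : E -> F) : \bar R :=
  ereal_sup [set (`|S x|)%:E | x in [set x | `|x| <= 1]].

Definition C0_semigroup {E : normedModType R} (T : R -> {linear E -> E}) : Prop :=
  [/\ forall t, 0 <= t -> continuous (T t),
      forall x, T 0 x = x,
      forall s t x, 0 <= s -> 0 <= t -> T (s + t) x = T s (T t x) &
      forall x, T t x @[t --> 0^'+] --> x].

                                                                           
Definition generates {E : normedModType R} (D : set E) (A : E -> E)
    (T : R -> {linear E -> E}) : Prop :=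
  forall x y, (D x /\ A x = y) <->
    (h^-1 *: (T h x - x) @[h --> 0^'+] --> y).

                                                                        
Definition is_resolvent {E : normedModType R} (D : set E) (A : E -> E)
    (a : R) (Ra : {linear E -> E}) : Prop :=
  [/\ continuous Ra,
      forall y, D (Ra y) /\ a *: Ra y - A (Ra y) = y &
      forall x, D x -> Ra (a *: x - A x) = x].

                                                                                
                                                                  
Definition is_extrapolation_space {X : normedModType R}
    {Y : completeNormedModType R} (D : set X) (A : X -> X)
    (j : {linear X -> Y}) : Prop :=
  dense (range j) /\
  exists a Ra, is_resolvent D A a Ra /\ forall x, `|j x| = `|Ra x|.

                                                         
Definition is_extension {X Y : normedModType R} (j : {linear X -> Y})
    (T : R -> {linear X -> X}) (T1 : R -> {linear Y -> Y}) : Prop :=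
  C0_semigroup T1 /\ forall t x, 0 <= t -> T1 t (j x) = j (T t x).

End semigroups.

Section admissibility.
Context {R : realType} {X U Y : normedModType R}.
Variables (j : {linear X -> Y}) (T1 : R -> {linear Y -> Y})
          (B : {linear U -> Y}).
Implicit Types (u : R -> U) (t : R).

                                       
Definition is_convolution t u (y : Y) : Prop :=
  is_Bochner_integral `[0, t] (fun s => T1 (t - s) (B (u s))) y.

Definition infty_admissible : Prop :=
  exists2 t, 0 < t &
    forall u, Linfty_loc u -> exists x : X, is_convolution t u (j x).

Definition admissibility_constants (h : R -> R) : Prop :=
  [/\ forall t, 0 < t -> 0 < h t,
      forall s t, 0 < s -> s <= t -> h s <= h t &
      forall t u, 0 < t -> Linfty_loc u -> exists x : X,
        is_convolution t u (j x) /\ `|x| <= h t * Linfty_norm `[0, t] u].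

Definition zero_class_infty_admissible : Prop :=
  exists h, admissibility_constants h /\ h t @[t --> 0^'+] --> (0 : R).

                                                                                 
Definition input_map t u : X := xget 0 [set x | is_convolution t u (j x)].

                                                                                
Definition input_map_continuous : Prop :=
  forall t0 u0, 0 <= t0 -> Linfty u0 ->
  forall e : R, 0 < e -> exists2 d : R, 0 < d &
    forall t u, 0 <= t -> Linfty u ->
      `|t - t0| < d -> Linfty_norm `[0, +oo[ (u - u0) < d ->
      `|input_map t u - input_map t0 u0| < e.

End admissibility.

Definition mild_solution {R : realType} {X U V Y : normedModType R}
    (j : {linear X -> Y}) (T : R -> {linear X -> X})
    (T1 : R -> {linear Y -> Y}) (B : {linear U -> Y}) (B2 : {linear V -> Y})
    (f : X -> U -> V) (x0 : X) (u : R -> U) (tau : R) (x : R -> X) : Prop :=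
  {within `[0, tau], continuous x} /\
  forall t, 0 <= t <= tau -> exists y2 y1,
    [/\ is_convolution T1 B2 t (fun s => f (x s) (u s)) y2,
        is_convolution T1 B t u y1 &
        j (x t) = j (T t x0) + y2 + y1].

(* Main.v *)
(* The equation is solved by iterating the map
     x |-> T(.) x0 + Phi_2(.) f(x, u) + Phi(.) u,
   Phi_2 being the input map of B_2. Zero-class admissibility makes the Lipschitz
   constant of this map on a ball of C([0, t1], X) as small as desired, and for t1
   small it also confines the image to the ball B_(M r + h_0 |u| + delta)(w),
   uniformly in w in Q because T(t) tends to the identity uniformly on compact
   sets. Uniqueness among all mild solutions, including those that leave the
   ball, is obtained on successive intervals of a fixed length: if two solutions
   agree on [0, a], the cocycle identity
     Phi_2(a + s) g = T(s) Phi_2(a) g + Phi_2(s) g(a + .)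
   turns their difference after a into an input over a short interval.
   This identity is an identity of Bochner integrals in X_(-1); since these are given
   only by approximating sequences of simple functions, uniqueness, additivity and
   translation invariance of the integral are proved from the definition. *)

Require Import Defs.
From HB Require Import structures.
From mathcomp Require Import all_boot all_order all_algebra.
From mathcomp Require Import all_classical all_reals all_analysis.
From mathcomp Require Import measurable_realfun ess_sup_inf ring lra.
Set Implicit Arguments.
Unset Strict Implicit.
Unset Printing Implicit Defensive.
Import Order.TTheory GRing.Theory Num.Theory.
Import numFieldNormedType.Exports.
Local Open Scope classical_set_scope.
Local Open Scope ring_scope.

(** * Lower integrals of possibly non-measurable functions *)

Section lower_integral.
Local Open Scope ereal_scope.
Context d (T : measurableType d) (R : realType).
Variables (mu : {measure set T -> \bar R}).
Implicit Types (f : T -> \bar R) (D N : set T).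

Import HBNNSimple.

(* The integral of a nonnegative function is a supremum over the simple functions
   below it, so monotonicity needs no measurability. *)
Lemma le_lower_integral D f1 f2 : (forall x, D x -> 0 <= f1 x) ->
  (forall x, D x -> f1 x <= f2 x) ->
  \int[mu]_(x in D) f1 x <= \int[mu]_(x in D) f2 x.
Proof.
move=> f10 f12; rewrite !ge0_integralE//; last first.
  by move=> x Dx; exact: le_trans (f10 _ Dx) (f12 _ Dx).
apply: ge_ereal_sup => _ [h hf <-]; apply: ereal_sup_ubound; exists h => //= x.
by apply: le_trans (hf x) _; exact: lee_restrict.
Qed.

(** Since [f] may be non-measurable, the null set is removed from the simple functions below [f]
    instead: each keeps its integral off [N], and there it still lies below [f]. *)
Lemma lower_integral_setD D f N : measurable N -> mu N = 0 ->
  (forall x, D x -> 0 <= f x) ->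
  \int[mu]_(x in D) f x = \int[mu]_(x in D `\` N) f x.
Proof.
move=> mN N0 f0; apply/eqP; rewrite eq_le; apply/andP; split; last first.
  rewrite integral_mkcond [leRHS]integral_mkcond; apply: le_lower_integral.
    by move=> x _; apply: erestrict_ge0 => y [Dy _]; exact: f0.
  move=> x _; rewrite /patch; case: ifPn => [/set_mem[Dx _]|_].
    by rewrite ifT//; exact: mem_set.
  by case: ifPn => // /set_mem; exact: f0.
rewrite ge0_integralE//; apply: ge_ereal_sup => _ [h hf <-].
rewrite -integralT_nnsfun (@ge0_negligible_integral _ _ _ _ _ N)//; last 2 first.
- by apply/measurable_EFinP; exact: measurable_funP.
- by move=> x _; rewrite lee_fin.
rewrite setTD integral_mkcond [leRHS]integral_mkcond.
apply: le_lower_integral => x _.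
  by apply: erestrict_ge0 => y _; rewrite lee_fin.
rewrite /patch; case: ifPn => [xN|]; last first.
  by move=> _; case: ifPn => // /set_mem[Dx _]; exact: f0.
have := hf x; rewrite /patch; move/set_mem : xN => xN; case: ifPn => Dx hx.
  by rewrite ifT//; apply/mem_set; split => //; exact: set_mem.
by rewrite memNset// => -[/mem_set + _]; exact/negP.
Qed.

Lemma ae_le_lower_integral D f1 f2 : (forall x, D x -> 0 <= f1 x) ->
  (forall x, D x -> 0 <= f2 x) -> {ae mu, forall x, D x -> f1 x <= f2 x} ->
  \int[mu]_(x in D) f1 x <= \int[mu]_(x in D) f2 x.
Proof.
move=> f10 f20 [N [mN N0 f12]].
rewrite (lower_integral_setD mN N0 f10) (lower_integral_setD mN N0 f20).
apply: le_lower_integral => x [Dx Nx]; first exact: f10.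
by apply: contra_notP Nx => f12x; apply: f12 => /= /(_ Dx).
Qed.

Lemma ae_eq_lower_integral D f1 f2 : (forall x, D x -> 0 <= f1 x) ->
  (forall x, D x -> 0 <= f2 x) -> {ae mu, forall x, D x -> f1 x = f2 x} ->
  \int[mu]_(x in D) f1 x = \int[mu]_(x in D) f2 x.
Proof.
move=> f10 f20 f12; apply/eqP; rewrite eq_le; apply/andP; split;
  apply: ae_le_lower_integral => //; apply: filterS f12 => x + Dx => /(_ Dx) ->//.
Qed.

Definition ae_measurable D f := exists F : T -> \bar R,
  [/\ measurable_fun [set: T] F, forall x, 0 <= F x &
      {ae mu, forall x, D x -> f x = F x}].

(** Lower integrals are not subadditive in general, so the two majorants are replaced by measurable
    representatives; [f] itself stays arbitrary. Every triangle inequality for error integrals below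
    is an instance. *)
Lemma lower_integral_le_addZ D f f1 f2 (c : R) : measurable D -> (0 <= c)%R ->
  ae_measurable D f1 -> ae_measurable D f2 ->
  (forall x, D x -> 0 <= f x) -> (forall x, D x -> 0 <= f1 x) ->
  (forall x, D x -> 0 <= f2 x) ->
  (forall x, D x -> f x <= f1 x + c%:E * f2 x) ->
  \int[mu]_(x in D) f x <= \int[mu]_(x in D) f1 x + c%:E * \int[mu]_(x in D) f2 x.
Proof.
move=> mD c0 [F1 [mF1 F10 fF1]] [F2 [mF2 F20 fF2]] f0 f10 f20 ff.
rewrite (ae_eq_lower_integral f10 _ fF1)// (ae_eq_lower_integral f20 _ fF2)//.
rewrite -ge0_integralZl_EFin//; last exact: measurable_funTS.
rewrite -ge0_integralD//; last 3 first.
- exact: measurable_funTS.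
- by move=> x _; rewrite mule_ge0.
- by apply: measurable_funTS; exact: measurable_funeM.
apply: ae_le_lower_integral => //; first by move=> x _; rewrite adde_ge0// mule_ge0.
by apply: filterS2 fF1 fF2 => x + + Dx => /(_ Dx) <- /(_ Dx) <-; exact: ff.
Qed.

End lower_integral.

(** * Simple functions *)

(* [simple_fun] without the norm on the codomain, so that pairs of simple functions
   and indicators can serve as common refinements. *)
Definition fin_meas {R : realType} {W : Type} (g : R -> W) : Prop :=
  finite_set (range g) /\ forall w, measurable (g @^-1` [set w]).

Section fin_meas.
Context {R : realType}.

Lemma fin_meas_range {W : Type} (g : R -> W) : fin_meas g -> finite_set (range g).
Proof. by case. Qed.

Lemma fin_meas_fiber {W : Type} (g : R -> W) w :
  fin_meas g -> measurable (g @^-1` [set w]).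
Proof. by case. Qed.

Lemma fin_meas_preimage {W : Type} (g : R -> W) (P : set W) :
  fin_meas g -> measurable (g @^-1` P).
Proof.
move=> [fg mg].
rewrite (_ : g @^-1` P = \bigcup_(w in range g `&` P) g @^-1` [set w]).
  by apply: fin_bigcup_measurable => //; exact: finite_setIl.
apply/seteqP; split=> [s /= Ps|s [w [_ Pw] /= ->]//].
by exists (g s) => //; split => //; exists s.
Qed.

Lemma fin_meas_comp {W W' : Type} (phi : W -> W') (g : R -> W) :
  fin_meas g -> fin_meas (phi \o g).
Proof.
move=> mg; split.
  by rewrite -(image_comp g phi); apply: finite_image; exact: fin_meas_range.
by move=> w; rewrite comp_preimage; exact: fin_meas_preimage.
Qed.

Lemma fin_meas_pair {W W' : Type} (g : R -> W) (g' : R -> W') :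
  fin_meas g -> fin_meas g' -> fin_meas (fun s => (g s, g' s)).
Proof.
move=> mg mg'; split.
  apply: sub_finite_set (finite_setX (fin_meas_range mg) (fin_meas_range mg')).
  by move=> _ [s _ <-]; split; exists s.
move=> [w w'].
rewrite (_ : _ @^-1` _ = g @^-1` [set w] `&` g' @^-1` [set w']).
  by apply: measurableI; [exact: fin_meas_fiber|exact: fin_meas_fiber].
by apply/seteqP; split=> s /=; [case=> -> ->|case=> -> ->].
Qed.

Lemma fin_meas_indic (D : set R) : measurable D -> fin_meas (fun s => s \in D).
Proof.
move=> mD; split; first exact: finite_finset.
move=> [|].
  rewrite (_ : _ @^-1` _ = D)//.
  by apply/seteqP; split=> s /=; [exact: set_mem|exact: mem_set].
rewrite (_ : _ @^-1` _ = ~` D); first exact: measurableC.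
apply/seteqP; split=> s /=; first by move=> /negbT; rewrite notin_setE.
by move=> ?; exact: memNset.
Qed.

Lemma fin_meas_measurable {W : Type} (phi : W -> \bar R) (g : R -> W) :
  fin_meas g -> measurable_fun [set: R] (phi \o g).
Proof.
move=> mg _ B mB; rewrite setTI comp_preimage; exact: fin_meas_preimage.
Qed.

End fin_meas.

Section simple_integral.
Context {R : realType}.
Notation mu := (@lebesgue_measure R).
Variables (D : set R).
Hypotheses (mD : measurable D) (fD : (mu D < +oo)%E).

Let fin_muI (A : set R) : measurable A -> mu (D `&` A) \is a fin_num.
Proof.
move=> mA; rewrite ge0_fin_numE//; apply: le_lt_trans fD.
by apply: le_measure; rewrite ?inE//; exact: measurableI.
Qed.

Lemma fin_meas_simple_integrable {E : normedModType R} (g : R -> E) :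
  fin_meas g -> simple_integrable D g.
Proof.
move=> mg; split => // v _; rewrite -ge0_fin_numE//; apply: fin_muI; exact: fin_meas_fiber.
Qed.

(** Each fibre of [phi \o g] is a finite disjoint union of fibres of [g]. Taking for [g] a pair of
    simple functions gives the common refinement on which sums and restrictions are computed. *)
Lemma simple_integral_comp {E : normedModType R} {W : choiceType} (phi : W -> E)
    (g : R -> W) : fin_meas g ->
  simple_integral D (phi \o g) =
  \sum_(w \in range g) fine (mu (D `&` g @^-1` [set w])) *: phi w.
Proof.
move=> mg; rewrite /simple_integral.
have fg := fin_meas_range mg; have fpg := fin_meas_range (fin_meas_comp phi mg).
(* The condition [phi w == v] sits in the summand, not in the index set, so that the two sums can be
   exchanged; afterwards only [v = phi w] survives. *)
transitivity (\sum_(v \in range (phi \o g)) \sum_(w \in range g)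
    fine (mu (D `&` g @^-1` [set w])) *: (if phi w == v then v else 0)).
  apply: eq_fsbigr => v _.
  rewrite (_ : mu _ = \sum_(w \in range g)
      (if phi w == v then mu (D `&` g @^-1` [set w]) else 0)%E); last first.
    rewrite (_ : D `&` _ = \bigcup_(w in range g)
        (if phi w == v then D `&` g @^-1` [set w] else set0)).
      rewrite measure_fin_bigcup//.
      - by apply: eq_fsbigr => w _; case: ifP => //; rewrite measure0.
      - move=> w1 w2 _ _ [s []]; case: ifP => // _ [_ /= <-].
        by case: ifP => // _ [_ /= <-].
      - by move=> w _; case: ifP => // _; apply: measurableI => //; exact: fin_meas_fiber.
    apply/seteqP; split=> [s [Ds /= ps]|s [w _]].
      by exists (g s); [exists s|rewrite /= ps eqxx].
    by case: eqP => // pw [Ds /= gs]; split => //=; rewrite gs.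
  transitivity ((\sum_(w \in range g)
    (if phi w == v then fine (mu (D `&` g @^-1` [set w])) else 0)) *: v).
    congr (_ *: v); rewrite -[RHS]/(fine (_)%:E) -fsumEFin//; congr fine.
    apply: eq_fsbigr => w _; case: ifP => // _; rewrite fineK//.
    by apply: fin_muI; exact: fin_meas_fiber.
  rewrite !fsbig_finite// scaler_suml; apply: eq_bigr => w _.
  by case: ifP => // _; rewrite ?scale0r ?scaler0.
rewrite exchange_fsbig//; apply: eq_fsbigr => w /set_mem[s _ gs].
rewrite (fsbigD1 (phi w))//=; last by exists s => //=; rewrite gs.
rewrite eqxx fsbig1 ?addr0// => v [_ /= vw].
by case: eqP => [/esym//|_]; rewrite scaler0.
Qed.

Lemma simple_integral_addZ {E : normedModType R} (c : R) (g g' : R -> E) :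
  fin_meas g -> fin_meas g' ->
  simple_integral D (fun s => g s + c *: g' s) =
  simple_integral D g + c *: simple_integral D g'.
Proof.
move=> mg mg'; have mgg := fin_meas_pair mg mg'.
rewrite (simple_integral_comp (fun w => w.1 + c *: w.2) mgg).
rewrite (simple_integral_comp fst mgg) (simple_integral_comp snd mgg).
have fgg := fin_meas_range mgg; rewrite !fsbig_finite//= scaler_sumr.
under eq_bigr do rewrite scalerDr scalerA mulrC -scalerA.
exact: big_split.
Qed.

Lemma simple_integral_linear {E F : normedModType R} (S : {linear E -> F})
    (g : R -> E) : fin_meas g ->
  simple_integral D (S \o g) = S (simple_integral D g).
Proof.
move=> mg; rewrite (simple_integral_comp S mg) /simple_integral.
have fg := fin_meas_range mg; rewrite !fsbig_finite//= raddf_sum.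
by apply: eq_bigr => w _; exact: esym (linearZZ _ _ _).
Qed.

Lemma le_norm_simple_integral {E : normedModType R} (g : R -> E) : fin_meas g ->
  (`|simple_integral D g|%:E <= \int[mu]_(s in D) `|g s|%:E)%E.
Proof.
move=> mg; have fg := fin_meas_range mg.
rewrite (eq_integral (mu := mu) (fun s => (\sum_(v \in range g)
    (`|v| * \1_(g @^-1` [set v]) s)%:E)%E)); last first.
  move=> s _; have gs : range g (g s) by exists s.
  rewrite (fsbigD1 (g s))//= indicE mem_set// mulr1.
  rewrite fsbig1 ?adde0// => v [_ /= vg].
  by rewrite indicE memNset ?mulr0//= => /esym.
rewrite ge0_integral_fsum//; last first.
  move=> v; apply/measurable_EFinP/measurable_funM => //.
  by apply: measurable_indic; exact: fin_meas_fiber.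
apply: (@le_trans _ _ (\sum_(v \in range g)
    (fine (mu (D `&` g @^-1` [set v])) * `|v|)%:E)%E).
  rewrite fsumEFin// lee_fin /simple_integral !fsbig_finite//.
  apply: le_trans (ler_norm_sum _ _ _) _; apply: ler_sum => v _.
  by rewrite normrZ ger0_norm// fine_ge0.
apply: lee_fsum => // v _.
under eq_integral do rewrite EFinM.
rewrite ge0_integralZl_EFin//; last first.
  by apply/measurable_EFinP/measurable_indic; exact: fin_meas_fiber.
have mv : measurable (g @^-1` [set v]) by exact: fin_meas_fiber.
by rewrite integral_indic// (setIC _ D) muleC EFinM fineK//; exact: fin_muI.
Qed.

End simple_integral.

(** * The Bochner integral *)

Section Bochner.
Context {R : realType}.
Notation mu := (@lebesgue_measure R).
Implicit Types D : set R.

Let ae_filter : Filter (almost_everywhere mu).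
Proof. exact: ae_filter_ringOfSetsType. Qed.

Lemma ae_mono (P Q : R -> Prop) : (forall s, P s -> Q s) ->
  {ae mu, forall s, P s} -> {ae mu, forall s, Q s}.
Proof. exact: (@filterS _ _ ae_filter). Qed.

Lemma ae_mono2 (P Q P' : R -> Prop) : (forall s, P s -> Q s -> P' s) ->
  {ae mu, forall s, P s} -> {ae mu, forall s, Q s} -> {ae mu, forall s, P' s}.
Proof. exact: (@filterS2 _ _ ae_filter). Qed.

(* [lebesgue_measure] lives on the Borel sets and is not complete, so an a.e. limit
   of simple functions is only a.e. equal to a measurable function. *)
Lemma ae_limit_ae_measurable {E : normedModType R} D (gn : (R -> E)^nat)
    (g h : R -> E) : (forall n, fin_meas (gn n)) -> fin_meas h ->
  ae_limit D gn g -> ae_measurable mu D (fun s => `|g s - h s|%:E).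
Proof.
move=> mgn mh gng; exists (fun s => limn_esup (fun n => `|gn n s - h s|%:E)).
split.
- apply: measurable_fun_limn_esup => n.
  exact: (fin_meas_measurable (fun w => `|w.1 - w.2|%:E) (fin_meas_pair (mgn n) mh)).
- by move=> s; apply: limf_esup_ge0 => [|n]; [exact: filter_not_empty|rewrite lee_fin].
- apply: ae_mono gng => s + Ds => /(_ Ds) gs.
  have gs' : `|gn n s - h s|%:E @[n --> \oo] --> `|g s - h s|%:E.
    apply: cvg_EFin; first exact: nearW.
    by apply: cvg_norm; apply: cvgB => //; exact: cvg_cst.
  by rewrite limn_esup_lim; have /cvg_lim <- := cvg_esups gs'.
Qed.

Lemma squeeze_addZ_cvge0 (c : R) (f A B : (\bar R)^nat) : (0 <= c)%R ->
  (forall n, (0 <= f n <= A n + c%:E * B n)%E) ->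
  A n @[n --> \oo] --> 0%E -> B n @[n --> \oo] --> 0%E ->
  f n @[n --> \oo] --> 0%E.
Proof.
move=> c0 fAB A0 B0.
apply: (@squeeze_cvge _ _ _ _ (cst 0%E) _ (fun n => A n + c%:E * B n)%E).
- exact: nearW.
- exact: cvg_cst.
- have cB : (c%:E * B n)%E @[n --> \oo] --> (c%:E * 0)%E by exact: cvgeZl.
  by rewrite mule0 in cB; have := cvgeD _ A0 cB; rewrite adde0; exact.
Qed.

Section finite_measure.
Variable D : set R.
Hypotheses (mD : measurable D) (fD : (mu D < +oo)%E).

(** The integrals of two approximating sequences differ by at most the sum of the two error
    integrals, which tends to 0. *)
Lemma is_Bochner_integral_unique {E : normedModType R} (g : R -> E) y y' :
  is_Bochner_integral D g y -> is_Bochner_integral D g y' -> y = y'.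
Proof.
move=> [gn [sg ag ig cg]] [hn [sh ah ih ch]].
have mg n : fin_meas (gn n) by case: (sg n).
have mh n : fin_meas (hn n) by case: (sh n).
suff d0 : `|simple_integral D (gn n) - simple_integral D (hn n)|%:E
    @[n --> \oo] --> 0%E.
  move/fine_cvgP : d0 => [_ d0].
  have /(cvg_unique _ d0) : `|simple_integral D (gn n) - simple_integral D (hn n)|
      @[n --> \oo] --> `|y - y'| by apply: cvg_norm; exact: cvgB.
  by move=> /(_ (@Rhausdorff R))/esym/eqP; rewrite normr_eq0 subr_eq0 => /eqP.
apply: squeeze_addZ_cvge0 ig ih => [|n]; first exact: ler01.
rewrite lee_fin normr_ge0/=.
have := simple_integral_addZ mD fD (-1) (mg n) (mh n); rewrite scaleN1r => <-.
apply: le_trans (le_norm_simple_integral mD fD _) _.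
  exact: (fin_meas_comp (fun w => w.1 + -1 *: w.2) (fin_meas_pair (mg n) (mh n))).
apply: lower_integral_le_addZ => //.
- exact: ae_limit_ae_measurable ag.
- exact: ae_limit_ae_measurable ah.
- move=> s _; rewrite mul1e -EFinD lee_fin scaleN1r.
  by rewrite (distrC (g s) (gn n s)); exact: ler_distD.
Qed.

Lemma is_Bochner_integral_ae {E : normedModType R} (g g' : R -> E) y :
  {ae mu, forall s, D s -> g s = g' s} ->
  is_Bochner_integral D g y -> is_Bochner_integral D g' y.
Proof.
move=> gg' [gn [sg ag ig cg]]; exists gn; split => //.
- by apply: ae_mono2 gg' ag => s + + Ds => /(_ Ds) <- /(_ Ds).
- apply: cvg_trans ig; apply: near_eq_cvg; apply: nearW => n.
  apply: ae_eq_lower_integral => //.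
  by apply: ae_mono gg' => s + Ds => /(_ Ds) ->.
Qed.

Lemma is_Bochner_integral_linear {E F : normedModType R} (S : {linear E -> F})
    (g : R -> E) y : continuous S ->
  is_Bochner_integral D g y -> is_Bochner_integral D (S \o g) (S y).
Proof.
move=> cS [gn [sg ag ig cg]].
have mg n : fin_meas (gn n) by case: (sg n).
have [C C0 SC] : exists2 C, 0 < C & forall x, `|S x| <= C * `|x|.
  have /linear_boundedP [C [Cr SC]] := continuous_linear_bounded 0 (cS 0).
  exists (Num.max 1 C + 1) => [|x]; first by rewrite ltr_wpDl// le_max ler01.
  apply: SC; by rewrite ltr_pwDr// le_max lexx orbT.
exists (fun n => S \o gn n); split.
- by move=> n; apply: fin_meas_simple_integrable => //; exact: fin_meas_comp.
- apply: ae_mono ag => s + Ds => /(_ Ds) gs.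
  exact: (cvg_comp _ _ gs (cS _)).
(* The error grows at most by the factor [C]; the other summand of the squeeze is filled with the
   integral of 0. *)
- apply: (@squeeze_addZ_cvge0 C _ (fun=> \int[mu]_(s in D) cst 0%E s)%E) ig.
  + exact: ltW.
  + move=> n; rewrite integral_ge0//=.
    apply: lower_integral_le_addZ => //; first exact: ltW.
    * by exists (cst 0%E); split=> //; apply: aeW => s _.
    * exact: (ae_limit_ae_measurable mg (mg n) ag).
    * by move=> s _; rewrite add0e -EFinM lee_fin -raddfB; exact: SC.
  + by rewrite integral0; exact: cvg_cst.
- under eq_fun do rewrite simple_integral_linear//.
  exact: (cvg_comp _ _ cg (cS _)).
Qed.

Lemma is_Bochner_integral_addZ {E : normedModType R} (c : R) (g g' : R -> E) y y' :
  is_Bochner_integral D g y -> is_Bochner_integral D g' y' ->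
  is_Bochner_integral D (fun s => g s + c *: g' s) (y + c *: y').
Proof.
move=> [gn [sg ag ig cg]] [hn [sh ah ih ch]].
have mg n : fin_meas (gn n) by case: (sg n).
have mh n : fin_meas (hn n) by case: (sh n).
exists (fun n s => gn n s + c *: hn n s); split.
- move=> n; apply: fin_meas_simple_integrable => //.
  exact: (fin_meas_comp (fun w => w.1 + c *: w.2) (fin_meas_pair (mg n) (mh n))).
- apply: ae_mono2 ag ah => s + + Ds => /(_ Ds) gs /(_ Ds) hs.
  by apply: cvgD => //; exact: cvgZl_tmp.
- apply: (squeeze_addZ_cvge0 (normr_ge0 c)) ig ih => n.
  rewrite integral_ge0//=; apply: lower_integral_le_addZ => //.
  + exact: ae_limit_ae_measurable ag.
  + exact: ae_limit_ae_measurable ah.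
  + move=> s _; rewrite -EFinM -EFinD lee_fin -normrZ opprD addrACA -scalerBr.
    exact: ler_normD.
- under eq_fun do rewrite simple_integral_addZ//.
  by apply: cvgD => //; exact: cvgZl_tmp.
Qed.

(** Extension by zero brings integrals over different intervals to a common one, where they can be
    added. *)
Lemma is_Bochner_integral_extend {E : normedModType R} (D1 : set R) (g : R -> E) y :
  measurable D1 -> D1 `<=` D -> is_Bochner_integral D1 g y ->
  is_Bochner_integral D (fun s => if s \in D1 then g s else 0) y.
Proof.
move=> mD1 D1D [gn [sg ag ig cg]].
have mg n : fin_meas (gn n) by case: (sg n).
have fD1 : (mu D1 < +oo)%E by apply: le_lt_trans fD; apply: le_measure; rewrite ?inE.
have m1 n := fin_meas_pair (mg n) (fin_meas_indic mD1).
exists (fun n s => if s \in D1 then gn n s else 0); split.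
- move=> n; apply: fin_meas_simple_integrable => //.
  exact: (fin_meas_comp (fun w => if w.2 then w.1 else 0) (m1 n)).
- apply: ae_mono ag => s gs Ds; case: ifPn => [/set_mem /gs//|_].
  exact: cvg_cst.
- apply: cvg_trans ig; apply: near_eq_cvg; apply: nearW => n.
  rewrite -[in LHS](setIidr D1D) integral_mkcondr; apply: eq_integral => s _.
  by rewrite /patch; case: ifPn => // _; rewrite subrr normr0.
- apply: cvg_trans cg; apply: near_eq_cvg; apply: nearW => n.
  rewrite (simple_integral_comp mD1 fD1 fst (m1 n)).
  rewrite (simple_integral_comp mD fD (fun w => if w.2 then w.1 else 0) (m1 n)).
  (* Pairs with flag [false] contribute nothing on either side: over [D] their value is 0, over [D1]
     their fibre is empty. *)
  apply: eq_fsbigr => -[v b] _ /=; case: b.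
    congr (fine (mu _) *: v); apply/seteqP; split=> s [Ds /= [gs s1]].
      by split; [exact: D1D|rewrite /= gs s1].
    by split; [exact: set_mem|rewrite /= gs s1].
  rewrite scaler0 (_ : _ `&` _ = set0) ?measure0 ?scale0r//.
  by rewrite -subset0 => s [/mem_set D1s /=] [_]; rewrite D1s.
Qed.

End finite_measure.

End Bochner.

(** * Translations *)

Section translation.
Context {R : realType}.
Notation mu := (@lebesgue_measure R).
Implicit Types (D : set R) (a : R).

Definition shiftr a (s : R) : R := s + a.

Lemma measurable_shiftr a : measurable_fun [set: measurableTypeR R]
  (shiftr a : _ -> measurableTypeR R).
Proof. exact: (measurable_funD (@measurable_id _ _ _) (measurable_cst a)). Qed.

Lemma measurable_preimage_shiftr a D :
  measurable D -> measurable (shiftr a @^-1` D).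
Proof. by move=> mD; rewrite -[X in measurable X]setTI; exact: measurable_shiftr. Qed.

Lemma preimage_shiftr_itv a b0 b1 x y :
  shiftr a @^-1` [set` Interval (BSide b0 x) (BSide b1 y)] =
  [set` Interval (BSide b0 (x - a)) (BSide b1 (y - a))].
Proof.
apply/seteqP; split=> s /=; rewrite !in_itv/= /shiftr;
  by case: b0; case: b1; rewrite /= ?lerBlDr ?ltrBlDr ?lerBrDr ?ltrBrDr.
Qed.

(** The image of Lebesgue measure under a translation agrees with it on half-open intervals, which
    determine it. *)
Lemma lebesgue_measure_shiftr a D : measurable D ->
  mu (shiftr a @^-1` D) = mu D.
Proof.
move=> mD; pose f : measurableTypeR R -> measurableTypeR R := shiftr a.
have mf : measurable_fun setT f by exact: measurable_shiftr.
pose f' : {mfun measurableTypeR R >-> measurableTypeR R} :=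
  HB.pack f (isMeasurableFun.Build _ _ _ _ f mf).
rewrite -[LHS]/(pushforward mu f' D).
apply/esym/lebesgue_measure_unique => //= _ [[x y]] _ <-.
rewrite /pushforward preimage_shiftr_itv /= !lebesgue_measure_itv/=.
rewrite !lte_fin ltrD2r; case: ifP => // _.
by rewrite -!EFinD opprB addrA subrK.
Qed.

Lemma ae_shiftr a (P : R -> Prop) :
  {ae mu, forall s, P s} -> {ae mu, forall s, P (shiftr a s)}.
Proof.
move=> [N [mN N0 PN]]; exists (shiftr a @^-1` N); split.
- exact: measurable_preimage_shiftr.
- by rewrite lebesgue_measure_shiftr.
- by move=> s /= /PN.
Qed.

(** Change of variables is applied to a measurable representative of [f]; passing to it and back is
    harmless because translations preserve null sets. *)
Lemma lower_integral_shiftr a D (f : R -> \bar R) : measurable D ->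
  ae_measurable mu D f -> (forall s, D s -> (0 <= f s)%E) ->
  (\int[mu]_(s in shiftr a @^-1` D) f (shiftr a s) = \int[mu]_(s in D) f s)%E.
Proof.
move=> mD [F [mF F0 fF]] f0.
transitivity (\int[mu]_(s in D) F s)%E; last first.
  by apply/esym; apply: ae_eq_lower_integral.
transitivity (\int[mu]_(s in shiftr a @^-1` D) F (shiftr a s))%E.
  apply: ae_eq_lower_integral => //; first by move=> s /= /f0.
  exact: (ae_shiftr a fF).
pose f_ : measurableTypeR R -> measurableTypeR R := shiftr a.
have mf : measurable_fun setT f_ by exact: measurable_shiftr.
rewrite -(ge0_integral_pushforward mf)//; last exact: measurable_funTS.
pose f' : {mfun measurableTypeR R >-> measurableTypeR R} :=
  HB.pack f_ (isMeasurableFun.Build _ _ _ _ f_ mf).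
rewrite -[LHS]/(\int[pushforward mu f']_(y in D) F y)%E.
apply: eq_measure_integral => A mA _.
exact: lebesgue_measure_shiftr.
Qed.

Lemma fin_meas_shiftr {W : Type} a (g : R -> W) :
  fin_meas g -> fin_meas (g \o shiftr a).
Proof.
move=> mg; split.
  by apply: sub_finite_set (fin_meas_range mg) => _ [s _ <-]; exists (shiftr a s).
move=> w; rewrite comp_preimage; apply: measurable_preimage_shiftr.
exact: fin_meas_fiber.
Qed.

Lemma range_shiftr {W : Type} a (g : R -> W) : range (g \o shiftr a) = range g.
Proof.
apply/seteqP; split=> _ [s _ <-]; first by exists (shiftr a s).
by exists (s - a) => //=; rewrite /shiftr subrK.
Qed.

Lemma is_Bochner_integral_shiftr {E : normedModType R} a D (g : R -> E) y :
  measurable D -> (mu D < +oo)%E ->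
  is_Bochner_integral D g y ->
  is_Bochner_integral (shiftr a @^-1` D) (g \o shiftr a) y.
Proof.
move=> mD fD [gn [sg ag ig cg]].
have mg n : fin_meas (gn n) by case: (sg n).
have mDa := measurable_preimage_shiftr a mD.
exists (fun n => gn n \o shiftr a); split.
- move=> n; apply: fin_meas_simple_integrable => //.
    by rewrite lebesgue_measure_shiftr.
  exact: fin_meas_shiftr.
- exact: (ae_shiftr a ag).
- apply: cvg_trans ig; apply: near_eq_cvg; apply: nearW => n.
  rewrite (lower_integral_shiftr a (f := fun s => `|g s - gn n s|%:E))//.
  exact: (ae_limit_ae_measurable mg (mg n) ag).
- apply: cvg_trans cg; apply: near_eq_cvg; apply: nearW => n.
  rewrite /simple_integral range_shiftr; apply: eq_fsbigr => v _.
  congr (fine _ *: _); rewrite comp_preimage -preimage_setI.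
  rewrite lebesgue_measure_shiftr//; apply: measurableI => //.
  exact: fin_meas_fiber.
Qed.

End translation.

(** * Essentially bounded functions and convolutions *)

Section Linfty.
Context {R : realType} {E : normedModType R}.
Notation mu := (@lebesgue_measure R).
Implicit Types (D : set R) (g : R -> E).

Lemma Linfty_norm_ge0 D g : 0 <= Linfty_norm D g.
Proof.
apply: fine_ge0; apply: ess_sup_gee.
  (* Bounding an essential supremum below requires a space of positive measure; the unit interval
     witnesses this. *)
  apply: (@lt_le_trans _ _ (mu `[0%R, 1%R])).
    by rewrite lebesgue_measure_itv/= lte_fin ltr01 -EFinB lte_fin subr_gt0 ltr01.
  by apply: le_measure; rewrite ?inE//; exact: measurable_itv.
by apply: aeW => s; apply: erestrict_ge0 => x _; rewrite lee_fin.
Qed.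

Lemma Linfty_norm_le D g (K : R) : 0 <= K ->
  {ae mu, forall s, D s -> `|g s| <= K} -> Linfty_norm D g <= K.
Proof.
move=> K0 gK; rewrite /Linfty_norm.
set f := (_ \_ D).
have : (ess_sup mu f <= K%:E)%E.
  apply/ess_supP; apply: ae_mono gK => s gK; rewrite /f/patch.
  by case: ifPn => [/set_mem/gK|_]; rewrite lee_fin.
(* The value [+oo] is excluded by the bound; [fine] sends [-oo] to 0, which is where [0 <= K]
   enters. *)
by case: (ess_sup mu f) => //=.
Qed.

(** Essential boundedness keeps the essential supremum below [+oo], a value that [fine] would turn
    into 0. *)
Lemma ae_le_Linfty_norm D g : ess_bounded D g ->
  {ae mu, forall s, D s -> `|g s| <= Linfty_norm D g}.
Proof.
move=> [K gK]; rewrite /Linfty_norm; set f := (_ \_ D).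
have fK : (ess_sup mu f <= (Num.max K 0)%:E)%E.
  apply/ess_supP; apply: ae_mono gK => s gK; rewrite /f/patch.
  case: ifPn => [/set_mem/gK|_]; rewrite lee_fin le_max; first by move=> ->.
  by rewrite lexx orbT.
apply: ae_mono (ess_sup_ge mu f) => s + Ds; rewrite {1}/f/patch mem_set//.
by move: fK; case: (ess_sup mu f).
Qed.

Lemma Linfty_norm0 D g : (forall s, g s = 0) -> Linfty_norm D g = 0.
Proof.
move=> g0; apply/eqP; rewrite eq_le Linfty_norm_ge0 andbT.
by apply: Linfty_norm_le => //; apply: aeW => s _; rewrite g0 normr0.
Qed.

Lemma Linfty_Linfty_loc g : Linfty g -> Linfty_loc g.
Proof.
move=> [mg [K gK]]; split => // t t0; exists K; apply: ae_mono gK => s gK st.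
by apply: gK => /=; move: st; rewrite /= !in_itv/= => /andP[->].
Qed.

Lemma Linfty_locB g g' : Linfty_loc g -> Linfty_loc g' -> Linfty_loc (g \- g').
Proof.
move=> [[gn [sg ag]] bg] [[hn [sh ah]] bh]; split.
  exists (fun n => gn n \- hn n); split.
    by move=> n; exact: (fin_meas_comp (fun w => w.1 - w.2) (fin_meas_pair (sg n) (sh n))).
  by apply: ae_mono2 ag ah => s gs hs Ds; apply: cvgB; [exact: gs|exact: hs].
move=> t t0; have [K gK] := bg _ t0; have [K' hK] := bh _ t0.
exists (K + K'); apply: ae_mono2 gK hK => s gs hs Ds.
by apply: le_trans (ler_normB _ _) _; apply: lerD; [exact: gs|exact: hs].
Qed.

Lemma Linfty_loc_shiftr a g : 0 <= a -> Linfty_loc g -> Linfty_loc (g \o shiftr a).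
Proof.
move=> a0 [[gn [sg ag]] bg]; split.
  exists (fun n => gn n \o shiftr a); split.
    by move=> n; exact: (fin_meas_shiftr a (sg n)).
  apply: ae_mono (ae_shiftr a ag) => s gs; rewrite /= in_itv/= andbT => s0.
  by apply: gs; rewrite /= in_itv/= andbT addr_ge0.
move=> t t0; have [K gK] := bg _ (addr_ge0 t0 a0).
exists K; apply: ae_mono (ae_shiftr a gK) => s gs.
rewrite /= in_itv/= => /andP[s0 st].
by apply: gs; rewrite /= in_itv/= addr_ge0//= lerD2r.
Qed.

End Linfty.

Section convolution.
Context {R : realType} {U Y : normedModType R}.
Variables (T1 : R -> {linear Y -> Y}) (B : {linear U -> Y}).
Notation mu := (@lebesgue_measure R).
Implicit Types (u : R -> U) (t : R).

Let measurable_seg t : measurable (`[0, t] : set (measurableTypeR R)).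
Proof. exact: measurable_itv. Qed.

Let fin_seg t : (mu `[0%R, t] < +oo)%E.
Proof. by rewrite lebesgue_measure_itv/=; case: ifP => // _; rewrite -EFinB ltry. Qed.

Lemma is_convolution_unique t u y y' :
  is_convolution T1 B t u y -> is_convolution T1 B t u y' -> y = y'.
Proof. exact: is_Bochner_integral_unique. Qed.

Lemma is_convolutionB t u u' y y' : is_convolution T1 B t u y ->
  is_convolution T1 B t u' y' -> is_convolution T1 B t (u \- u') (y - y').
Proof.
move=> uy uy'.
have := is_Bochner_integral_addZ (measurable_seg t) (fin_seg t) (-1) uy uy'.
rewrite scaleN1r; congr is_Bochner_integral; apply/funext => s.
by rewrite scaleN1r !linearB.
Qed.

Lemma eq_is_convolution t u u' y : {in `[0, t], u =1 u'} ->
  is_convolution T1 B t u y -> is_convolution T1 B t u' y.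
Proof.
move=> uu'; apply: is_Bochner_integral_ae => //.
by apply: aeW => s st; rewrite uu'.
Qed.

(** The interval [0, 0] is a null set, so the zero sequence approximates any integrand, measurable
    or not. *)
Lemma is_convolution0 u : is_convolution T1 B 0 u 0.
Proof.
have null : mu `[0%R, 0%R] = 0%E by rewrite set_itv1 lebesgue_measure_set1.
have c0 : fin_meas (cst (0 : Y) : R -> Y).
  exact: (fin_meas_comp (fun=> 0) (fin_meas_indic measurableT)).
exists (fun=> cst 0); split.
- by move=> n; exact: fin_meas_simple_integrable.
- exists `[0, 0]%classic; split => // s /=.
  by apply: contra_notP => s0 /s0.
- rewrite (_ : (fun _ => _) = cst 0%E); first exact: cvg_cst.
  apply/funext => n.
  rewrite (@lower_integral_setD _ _ _ mu _ _ `[0%R, 0%R]%classic)//.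
  by rewrite setDv integral_set0.
- rewrite (_ : (fun _ => _) = cst 0); first exact: cvg_cst.
  apply/funext => n; apply: fsbig1 => v _.
  rewrite (_ : mu _ = 0%E) ?scale0r//; apply: subset_measure0 null => //.
  by apply: measurableI => //; exact: fin_meas_fiber.
Qed.

Hypotheses (T1c : forall t, 0 <= t -> continuous (T1 t))
  (T1D : forall s t x, 0 <= s -> 0 <= t -> T1 (s + t) x = T1 s (T1 t x)).

(** The operator [T1 s] moves inside the first integral and turns [T1 (a - x)] into
    [T1 (a + s - x)]; the second integral is translated to [a, a + s]. Both are extended by zero to
    [0, a + s] and added. *)
Lemma is_convolution_cocycle a s u y y' : 0 <= a -> 0 <= s ->
  is_convolution T1 B a u y -> is_convolution T1 B s (u \o shiftr a) y' ->
  is_convolution T1 B (a + s) u (T1 s y + y').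
Proof.
move=> a0 s0 uy uy'.
have mI := measurable_seg (a + s); have fI := fin_seg (a + s).
have b1 := is_Bochner_integral_linear (measurable_seg a) (fin_seg a) (T1c s0) uy.
have {}b1 := is_Bochner_integral_extend mI fI (measurable_seg a) _ b1.
have b2 := is_Bochner_integral_shiftr (- a) (measurable_seg s) (fin_seg s) uy'.
have {}b2 := is_Bochner_integral_extend mI fI
  (measurable_preimage_shiftr _ (measurable_seg s)) _ b2.
have := is_Bochner_integral_addZ mI fI 1 (b1 _) (b2 _); rewrite scale1r.
move=> b; apply: is_Bochner_integral_ae (b _ _) => //.
(* At [a] both pieces contribute, so the sum is the right integrand only off this point. *)
- exists [set a]; split => //; first by rewrite lebesgue_measure_set1.
  move=> x /=; apply: contra_notP => xa /[!in_itv]/= /andP[x0 xas].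
  rewrite scale1r preimage_shiftr_itv add0r opprK (addrC s).
  case: (ltgtP x a) => [xa1|xa1|//].
    rewrite ifT ?ifF ?addr0 /= -?T1D ?subr_ge0 ?(ltW xa1)//.
    - by congr (T1 _ _); ring.
    - by apply: memNset; rewrite /= in_itv/= leNgt xa1.
    - by apply: mem_set; rewrite /= in_itv/= x0 ltW.
  rewrite ifF ?ifT ?add0r /shiftr /=.
  - by congr (T1 _ (B (u _))); ring.
  - by apply: mem_set; rewrite /= in_itv/= ltW.
  - by apply: memNset; rewrite /= in_itv/= x0/= leNgt xa1.
- by move=> x /=; rewrite !in_itv/= => /andP[-> xa]; rewrite (le_trans xa)// lerDl.
- move=> x; rewrite preimage_shiftr_itv/= !in_itv/= add0r opprK => /andP[ax xs].
  by rewrite (le_trans a0 ax) addrC.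
Qed.

End convolution.

(** * Semigroups *)

Lemma near_right0P {R : realType} (P : R -> Prop) :
  (\forall t \near 0^'+, P t) ->
  exists2 d : R, 0 < d & forall t, 0 < t -> t <= d -> P t.
Proof.
move=> /nbhs_ballP[d /= d0 dP]; exists (d / 2); first by rewrite divr_gt0.
move=> t t0 td; apply: dP => //=; rewrite /ball/= sub0r normrN gtr0_norm//.
by apply: le_lt_trans td _; rewrite ltr_pdivrMr// ltr_pMr// ltr1n.
Qed.

Lemma le_op_norm {R : realType} {E F : normedModType R} (S : {linear E -> F})
    (K : R) : (op_norm S <= K%:E)%E -> forall x, `|S x| <= K * `|x|.
Proof.
move=> SK x; have [->|x0] := eqVneq x 0; first by rewrite linear0 !normr0 mulr0.
have nx0 : 0 < `|x| by rewrite normr_gt0.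
rewrite -ler_pdivrMr//.
have -> : `|S x| / `|x| = `|S (`|x|^-1 *: x)|.
  by rewrite linearZZ normrZ gtr0_norm ?invr_gt0// mulrC.
rewrite -lee_fin; apply: le_trans SK; apply: ereal_sup_ubound => /=.
exists (`|x|^-1 *: x) => //=.
by rewrite normrZ gtr0_norm ?invr_gt0// mulVf ?gt_eqF.
Qed.

Section semigroup.
Context {R : realType} {X : normedModType R}.
Variables (T : R -> {linear X -> X}) (hT : C0_semigroup T).
Variables (M lambda : R) (hM : 1 <= M) (hlambda : 0 < lambda).
Hypothesis hMT : forall t : R, 0 <= t ->
  (op_norm (T t) <= (M * expR (lambda * t))%:E)%E.

Lemma semigroup_le t t0 x : 0 <= t -> t <= t0 ->
  `|T t x| <= M * expR (lambda * t0) * `|x|.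
Proof.
move=> t0' tt0; apply: le_trans (le_op_norm (hMT t0') x) _.
apply: ler_wpM2r => //; apply: ler_wpM2l; first exact: le_trans hM.
by rewrite ler_expR ler_pM2l.
Qed.

Lemma semigroup_cvg0 x (e : R) : 0 < e ->
  exists2 d : R, 0 < d & forall t, 0 <= t -> t <= d -> `|T t x - x| < e.
Proof.
move=> e0; have [_ T0 _ /(_ x) Tx] := hT.
have /near_right0P[d d0 dT] : \forall t \near 0^'+, `|x - T t x| < e.
  by move/cvgrPdist_lt : Tx; apply.
exists d => // t; rewrite le_eqVlt => /predU1P[<- _|].
  by rewrite T0 subrr normr0.
by move=> t0 /(dT _ t0); rewrite distrC.
Qed.

(** Factoring out the operator at the smaller of the two times, which is at most [t0] and hence
    bounded by [K], reduces both one-sided limits to continuity at 0. *)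
Lemma semigroup_cvg x t0 (e : R) : 0 <= t0 -> 0 < e ->
  exists2 d : R, 0 < d &
    forall t, 0 <= t -> `|t - t0| < d -> `|T t x - T t0 x| < e.
Proof.
move=> t0_ge0 e0; set K := M * expR (lambda * t0).
have K0 : 0 < K by rewrite mulr_gt0 ?expR_gt0//; exact: lt_le_trans hM.
have [d d0 dT] := semigroup_cvg0 x (divr_gt0 e0 K0).
have TB s t : 0 <= s -> s <= t -> s <= t0 -> t - s < d -> `|T t x - T s x| < e.
  move=> s0 st st0 tsd; have [_ _ TD _] := hT.
  rewrite -(subrKC s t) TD ?subr_ge0// -raddfB.
  apply: le_lt_trans (semigroup_le _ s0 st0) _.
  by rewrite -/K mulrC -ltr_pdivlMr//; apply: dT; rewrite ?subr_ge0// ltW.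
exists d => // t t_ge0; have [tt0|/ltW t0t] := leP t t0.
  by rewrite distrC => td; rewrite distrC; apply: TB => //; apply: le_lt_trans td; exact: ler_norm.
by move=> td; apply: TB => //; apply: le_lt_trans td; exact: ler_norm.
Qed.

(** The operators [T t] with [t <= 1] are uniformly bounded, so a time that works for one [w] works
    on a neighbourhood of [w]; compactness, in its near-covering form, makes it uniform. *)
Lemma semigroup_compact_cvg (Q : set X) (e : R) : compact Q -> 0 < e ->
  exists2 d : R, 0 < d &
    forall t w, 0 <= t -> t <= d -> Q w -> `|T t w - w| < e.
Proof.
move=> /compact_near_coveringP cQ e0.
set K := M * expR (lambda * 1).
have K0 : 0 < K by rewrite mulr_gt0 ?expR_gt0//; exact: lt_le_trans hM.
have : \forall t \near (0 : R)^'+, Q `<=` [set w | `|T t w - w| < e].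
  apply: (cQ _ _ (fun t w => `|T t w - w| < e)) => w Qw.
  have [d d0 dT] := semigroup_cvg0 w (divr_gt0 e0 (ltr0Sn R 1)).
  (* Replacing [w'] by [w] costs at most (K + 1)|w - w'| < e / 2; the orbit of [w] takes the other
     half. *)
  exists ([set w' | `|w - w'| < e / 2 / (K + 1)],
          [set t | 0 < t /\ t <= Num.min 1 d]) => /=.
    split.
      apply/nbhs_ballP; exists (e / 2 / (K + 1)) => /=.
        by rewrite !divr_gt0// addr_gt0.
      by move=> w'; rewrite -ball_normE.
    apply: filterI; first exact: nbhs_right_gt.
    by apply: nbhs_right_le; rewrite lt_min ltr01.
  move=> [w' t] /= [ww' [t0]]; rewrite le_min => /andP[t1 td].
  have -> : T t w' - w' = T t (w' - w) + (T t w - w) + (w - w').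
    by rewrite raddfB /= (addrA (_ - T t w)) subrK addrA subrK.
  apply: le_lt_trans (ler_normD _ _) _.
  apply: le_lt_trans (lerD (ler_normD _ _) (lexx _)) _.
  have TK := semigroup_le (w' - w) (ltW t0) t1.
  rewrite -/K distrC in TK.
  have Tw := dT t (ltW t0) td.
  move: ww'; rewrite ltr_pdivlMr ?addr_gt0// => ww'.
  nra.
move=> /near_right0P[d d0 dP]; exists d => // t w.
rewrite le_eqVlt => /predU1P[<- _ _|t0 td Qw]; last exact: (dP t).
by have [_ -> _ _] := hT; rewrite subrr normr0.
Qed.

End semigroup.

(** The norm of [j x] is that of [Ra x], and the resolvent [Ra] is injective. *)
Lemma extrapolation_inj {R : realType} {X : normedModType R}
    {Y : completeNormedModType R} (D : set X) (A : X -> X)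
    (T : R -> {linear X -> X}) (j : {linear X -> Y}) :
  generates D A T -> is_extrapolation_space D A j -> injective j.
Proof.
move=> gA [_ [a [Ra [[_ RaA _] jRa]]]] x x' jxx'.
apply/eqP; rewrite -subr_eq0; apply/eqP; set z := x - x'.
have Raz : Ra z = 0.
  by apply/normr0_eq0; rewrite -jRa /z linearB /= jxx' subrr normr0.
have [D0 A0] := RaA z; rewrite Raz in D0 A0.
(* Linearity of [A] is not part of its type; [A 0 = 0] is read off from the difference quotient at
   0. *)
have : h^-1 *: (T h 0 - 0) @[h --> 0^'+] --> A 0 by exact: (gA 0 (A 0)).1.
rewrite (_ : (fun h => _) = cst 0); last first.
  by apply/funext => h; rewrite raddf0 subr0 scaler0.
move=> /(cvg_unique _ (cvg_cst (0 : X))) => /(_ (@norm_hausdorff _ X)) A00.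
by rewrite -A0 -A00 scaler0 subr0.
Qed.

(** * Input maps *)

Section input_map.
Context {R : realType} {X U Y : normedModType R}.
Variables (j : {linear X -> Y}) (T : R -> {linear X -> X})
  (T1 : R -> {linear Y -> Y}) (B : {linear U -> Y}).
Hypotheses (jinj : injective j) (hT1 : is_extension j T T1).
Variable h : R -> R.
Hypothesis hh : admissibility_constants j T1 B h.
Notation mu := (@lebesgue_measure R).
Notation Phi := (input_map j T1 B).
Implicit Types (u : R -> U) (t : R).

(** [input_map] chooses a value, with default 0; uniqueness of the integral and injectivity of [j]
    leave only one choice. *)
Lemma input_map_eq t u x : is_convolution T1 B t u (j x) -> Phi t u = x.
Proof.
move=> ux; apply: jinj; apply: (@is_convolution_unique _ _ _ T1 B t u) => //.
exact: (@xgetI _ 0 [set x | is_convolution T1 B t u (j x)] x ux).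
Qed.

Lemma input_map0 u : Phi 0 u = 0.
Proof. by apply: input_map_eq; rewrite raddf0; exact: is_convolution0. Qed.

Lemma input_mapP t u : 0 <= t -> Linfty_loc u ->
  is_convolution T1 B t u (j (Phi t u)).
Proof.
move=> t0 lu; suff [x ux] : exists x, is_convolution T1 B t u (j x).
  by rewrite (input_map_eq ux).
move: t0; rewrite le_eqVlt => /predU1P[<-|t0].
  by exists 0; rewrite raddf0; exact: is_convolution0.
by have [_ _ /(_ _ _ t0 lu)[x [ux _]]] := hh; exists x.
Qed.

Lemma input_map_leM t u (K : R) : 0 <= K -> 0 < t -> Linfty_loc u ->
  {ae mu, forall s, `[0, t]%classic s -> `|u s| <= K} -> `|Phi t u| <= h t * K.
Proof.
move=> K0 t0 lu uK; have [h0 _ /(_ _ _ t0 lu)[x [ux xh]]] := hh.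
rewrite (input_map_eq ux); apply: le_trans xh _.
by apply: ler_wpM2l; [exact: ltW (h0 _ t0)|exact: Linfty_norm_le].
Qed.

Lemma input_map_cocycle a s u : 0 <= a -> 0 <= s -> Linfty_loc u ->
  Phi (a + s) u = T s (Phi a u) + Phi s (u \o shiftr a).
Proof.
move=> a0 s0 lu; have [[T1c _ T1D _] T1j] := hT1; apply: input_map_eq.
rewrite raddfD /= -T1j//; apply: is_convolution_cocycle => //; first exact: input_mapP.
by apply: input_mapP => //; exact: Linfty_loc_shiftr.
Qed.

Lemma input_mapB t u u' : 0 <= t -> Linfty_loc u -> Linfty_loc u' ->
  Phi t (u \- u') = Phi t u - Phi t u'.
Proof.
move=> t0 lu lu'; apply: input_map_eq; rewrite raddfB /=.
by apply: is_convolutionB; exact: input_mapP.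
Qed.

Hypothesis h_zero : h t @[t --> 0^'+] --> (0 : R).

Lemma zero_class_small (e : R) : 0 < e ->
  exists2 d : R, 0 < d & forall t, 0 < t -> t <= d -> h t < e.
Proof.
move=> e0; apply: near_right0P; move/cvgrPdist_lt : h_zero => /(_ _ e0).
apply: filterS => t; rewrite sub0r normrN; apply: le_lt_trans; exact: ler_norm.
Qed.

Variables (hT : C0_semigroup T) (M lambda : R).
Hypotheses (hM : 1 <= M) (hlambda : 0 < lambda).
Hypothesis hMT : forall t : R, 0 <= t ->
  (op_norm (T t) <= (M * expR (lambda * t))%:E)%E.

(* By the cocycle identity from a time [a] slightly before [t0], the value near [t0]
   is the orbit of the fixed vector [Phi a u] plus an input over a short interval,
   which is small in zero class; this gives left and right continuity at once. *)
Lemma input_map_cvg u t0 (e : R) : Linfty_loc u -> 0 <= t0 -> 0 < e ->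
  exists2 d : R, 0 < d &
    forall t, 0 <= t -> `|t - t0| < d -> `|Phi t u - Phi t0 u| < e.
Proof.
move=> lu t0_ge0 e0; set K := Linfty_norm `[0, t0 + 1] u.
have K0 : 0 <= K by exact: Linfty_norm_ge0.
have uK : {ae mu, forall s, `[0, t0 + 1]%classic s -> `|u s| <= K}.
  by apply: ae_le_Linfty_norm; apply: lu.2; rewrite addr_ge0.
have K4 : 0 < 4 * (K + 1) by rewrite mulr_gt0// ltr_wpDl.
have [d1 d10 hd1] := zero_class_small (divr_gt0 e0 K4).
(* For [a >= t0 - eta] and |t - t0| < eta one has t - a < 2 eta <= d1, and [0, t] stays inside
   [0, t0 + 1], where [K] bounds [u]. *)
have [eta eta0 [etad1 eta1]] : exists2 eta, 0 < eta & eta <= d1 / 2 /\ eta <= 1 / 2.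
  exists (Num.min (d1 / 2) (1 / 2)); first by rewrite lt_min !divr_gt0.
  by split; rewrite ge_min lexx ?orbT.
have [a [a0 at0 aeta aE]] : exists a, [/\ 0 <= a, a <= t0, t0 - eta <= a &
    forall t, 0 <= t -> t0 - eta <= t -> a <= t].
  exists (Num.max 0 (t0 - eta)).
  split; rewrite ?le_max ?lexx ?orbT//.
    by rewrite ge_max t0_ge0 gerBl ltW.
  by move=> t ? ?; rewrite ge_max; apply/andP.
have small t : a <= t -> `|t - t0| < eta -> `|Phi (t - a) (u \o shiftr a)| < e / 4.
  rewrite le_eqVlt => /predU1P[<- _|at_].
    by rewrite subrr input_map0 normr0 divr_gt0.
  rewrite ltr_distlC => /andP[tt0 t0t].
  have ta0 : 0 < t - a by rewrite subr_gt0.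
  have tad : t - a <= d1 by lra.
  apply: (@le_lt_trans _ _ (h (t - a) * K)).
    apply: input_map_leM => //; first exact: Linfty_loc_shiftr.
    apply: ae_mono (ae_shiftr a uK) => s us; rewrite /= in_itv/= => /andP[s0 st].
    by apply: us; rewrite /= in_itv/= /shiftr addr_ge0//=; lra.
  have := hd1 _ ta0 tad; rewrite ltr_pdivlMr// => hK.
  have h0 : 0 < h (t - a) by case: hh => h0 _ _; exact: h0.
  by rewrite ltr_pdivlMr//; nra.
have ta0_ge0 : 0 <= t0 - a by rewrite subr_ge0.
have [d2 d20 Td] := semigroup_cvg hT hM hlambda hMT (Phi a u) ta0_ge0
  (divr_gt0 e0 (ltr0Sn R 1)).
exists (Num.min eta d2); first by rewrite lt_min eta0.
move=> t t_ge0; rewrite lt_min => /andP[teta td2].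
have at1 : a <= t.
  by apply: aE => //; move: teta; rewrite ltr_distlC => /andP[]; lra.
have PhiE s : a <= s -> Phi s u = T (s - a) (Phi a u) + Phi (s - a) (u \o shiftr a).
  by move=> as_; rewrite -(input_map_cocycle a0 _ lu) ?subr_ge0// subrKC.
rewrite (PhiE t)// (PhiE t0)// opprD addrACA; apply: le_lt_trans (ler_normD _ _) _.
have -> : e = e / 2 + (e / 4 + e / 4) by lra.
apply: ltrD.
  by apply: Td; rewrite ?subr_ge0// opprB addrA subrK.
apply: le_lt_trans (ler_normB _ _) _.
by apply: ltrD; apply: small => //; rewrite subrr normr0.
Qed.

End input_map.

(** * Fixed points of contractions on spaces of continuous functions *)

Lemma within_continuousP {R : realType} {X : normedModType R} (A : set R)
    (f : R -> X) :
  {within A, continuous f} <->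
  forall t, A t -> forall e : R, 0 < e ->
    exists2 d : R, 0 < d & forall s, A s -> `|s - t| < d -> `|f s - f t| < e.
Proof.
rewrite subspace_continuousP; split=> fA t At.
  move=> e e0; have /cvgrPdist_lt/(_ e e0)/nbhs_ballP[d /= d0 dA] := fA t At.
  exists d => // s As std; rewrite distrC; apply: dA => //.
  by rewrite -ball_normE /= distrC.
apply/cvgrPdist_lt => e e0; have [d d0 dA] := fA t At e e0.
apply/nbhs_ballP; exists d => // s; rewrite -ball_normE /= distrC => std As.
by rewrite distrC; exact: dA.
Qed.

Lemma le_half_powers {R : realType} (a c : R) :
  (forall n, a <= c * 2^-1 ^+ n) -> a <= 0.
Proof.
move=> ac; have cvg0 : c * 2^-1 ^+ n @[n --> \oo] --> 0.
  by apply: cvg_geometric; rewrite gtr0_norm ?invf_lt1// ltr1n.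
by rewrite -(cvg_lim _ cvg0)//; apply: limr_ge; [exact: cvgP cvg0|exact: nearW].
Qed.

Lemma half_steps_cvg {R : realType} {X : completeNormedModType R} (x : nat -> X)
    (c : R) : (forall n, `|x n.+1 - x n| <= c * 2^-1 ^+ n) ->
  exists l, forall n, `|l - x n| <= 2 * c * 2^-1 ^+ n.
Proof.
move=> xc; have xnk k n : `|x (k + n)%N - x n| <= 2 * c * 2^-1 ^+ n.
  elim: k n => [|k IH] n.
    rewrite subrr normr0 -mulrA mulr_ge0//.
    exact: le_trans (xc n).
  rewrite addSnnS; apply: le_trans (ler_distD (x n.+1) _ _) _.
  by apply: le_trans (lerD (IH n.+1) (xc n)) _; rewrite exprS; lra.
have cx : cvgn x.
  apply/cauchy_cvgP/cauchy_exP => e e0.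
  have cvg0 : 2 * c * 2^-1 ^+ n @[n --> \oo] --> 0.
    by apply: cvg_geometric; rewrite gtr0_norm ?invf_lt1// ltr1n.
  have [N _ /(_ N (leqnn N)) Ne] := (cvgrPdist_lt _ _).1 cvg0 e e0.
  exists (x N); exists N => // m /= Nm; rewrite -ball_normE /= distrC.
  rewrite -(subnK Nm); apply: le_lt_trans (xnk _ _) _.
  by move: Ne; rewrite sub0r normrN; apply: le_lt_trans; exact: ler_norm.
exists (limn x) => n; apply/ler_addgt0Pr => e e0.
have [N _ Ne] := (cvgrPdist_lt _ _).1 cx e e0.
apply: le_trans (ler_distD (x (N + n)%N) _ _) _; rewrite addrC; apply: lerD => //.
by apply: ltW; apply: Ne; exact: leq_addr.
Qed.

(** Banach's theorem without a function space: functions matter only on [A], and the sup norm is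
    replaced by arbitrary uniform bounds [K]. The iterates converge pointwise at a uniform geometric
    rate, so the limit is continuous on [A]. *)
Lemma contraction_fixed_point {R : realType} {X : completeNormedModType R}
    (A : set R) (F : (R -> X) -> R -> X) (w : X) (rho : R) :
  let P x := {within A, continuous x} /\ forall t, A t -> `|x t - w| <= rho in
  0 <= rho -> (forall x, P x -> P (F x)) ->
  (forall x y (K : R), P x -> P y -> 0 <= K ->
     (forall t, A t -> `|x t - y t| <= K) ->
     forall t, A t -> `|F x t - F y t| <= K / 2) ->
  exists2 x, P x & forall t, A t -> F x t = x t.
Proof.
move=> P rho0 FP FK; pose x n := iter n F (cst w).
have Pcst : P (cst w).
  by split=> [|t _]; [apply: continuous_subspaceT; exact: cst_continuous|rewrite subrr normr0].
have Px n : P (x n) by elim: n => //= n; exact: FP.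
have xS n t : A t -> `|x n.+1 t - x n t| <= rho * 2^-1 ^+ n.
  elim: n t => [|n IH] t At; first by rewrite expr0 mulr1; have [_] := Px 1; exact.
  rewrite exprSr mulrA; apply: (FK _ _ _ (Px n.+1) (Px n)) => //.
  by rewrite mulr_ge0// exprn_ge0.
have /choice[l lx] : forall t, exists l, A t ->
    forall n, `|l - x n t| <= 2 * rho * 2^-1 ^+ n.
  move=> t; have [At|nAt] := pselect (A t); last by exists 0.
  by have [l lx] := half_steps_cvg (fun n => xS n t At); exists l.
have Pl : P l.
  split; last first.
    move=> t At; rewrite -subr_le0; apply: (@le_half_powers _ _ (2 * rho)) => n.
    rewrite lerBlDr; apply: le_trans (ler_distD (x n t) _ _) _.
    by apply: lerD; [exact: lx|have [_] := Px n; exact].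
  apply/within_continuousP => t At e e0.
  have [n ne] : exists n, 2 * rho * 2^-1 ^+ n < e / 3.
    apply: contrapT => /forallNP H; have : e / 3 <= 0.
      by apply: (@le_half_powers _ _ (2 * rho)) => n; have /negP := H n; rewrite -leNgt.
    by lra.
  have [xnc _] := Px n.
  have [d d0 dA] := (within_continuousP _ _).1 xnc t At (e / 3) (divr_gt0 e0 (ltr0Sn R 2)).
  exists d => // s As std.
  apply: le_lt_trans (ler_distD (x n s) _ _) _.
  apply: le_lt_trans (lerD (lexx _) (ler_distD (x n t) _ _)) _.
  have := lx s As n; have := lx t At n; rewrite (distrC (x n t)).
  have := dA s As std; lra.
exists l => // t At; apply/eqP; rewrite -subr_eq0 -normr_le0.
(* Both |F l - x_(n+1)| and |x_(n+1) - l| are at most half of 2 rho 2^-n, the first by contraction,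
   the second by the rate. *)
apply: (@le_half_powers _ _ (2 * rho)) => n.
apply: le_trans (ler_distD (x n.+1 t) _ _) _.
have c0 : 0 <= 2 * rho * 2^-1 ^+ n by rewrite !mulr_ge0// exprn_ge0.
have := FK _ _ _ Pl (Px n) c0 (fun t At => lx t At n) t At.
have := lx t At n.+1; rewrite exprS (distrC (x _ t)) -/(x n.+1) /=; lra.
Qed.

(** * Mild solutions *)

Section mild_solution.
Context {R : realType} {X U V Y : normedModType R}.
Variables (j : {linear X -> Y}) (T : R -> {linear X -> X})
  (T1 : R -> {linear Y -> Y}) (B : {linear U -> Y}) (B2 : {linear V -> Y})
  (f : X -> U -> V).
Hypotheses (jinj : injective j) (hT1 : is_extension j T T1).
Variables (h h2 : R -> R).
Hypotheses (hh : admissibility_constants j T1 B h)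
  (hh2 : admissibility_constants j T1 B2 h2)
  (h2_zero : h2 t @[t --> 0^'+] --> (0 : R)).
Hypothesis hf : forall (u : R -> U) (x : R -> X), Linfty u ->
  {within `[0, +oo[, continuous x} -> Linfty_loc (fun s => f (x s) (u s)).
Hypothesis hLip : forall C : R, 0 < C -> exists2 L : R, 0 < L &
  forall (x y : X) (v : U), `|x| < C -> `|y| < C -> `|v| < C ->
    `|f y v - f x v| <= L * `|y - x|.
Notation mu := (@lebesgue_measure R).

Variables (u : R -> U) (tau : R).
Hypotheses (lu : Linfty u) (tau0 : 0 <= tau).

(* Stopping [x] at [tau] makes it continuous on the whole half-line, as required by
   the measurability hypothesis on [f]. *)
Definition stopped_input (x : R -> X) (s : R) : V := f (x (Num.min s tau)) (u s).

Lemma Linfty_loc_stopped_input x : {within `[0, tau], continuous x} ->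
  Linfty_loc (stopped_input x).
Proof.
move=> xc; apply: (hf lu (x := fun s => x (Num.min s tau))).
have min_tau s : 0 <= s -> `[0, tau]%classic (Num.min s tau).
  by move=> s0; rewrite /= in_itv/= le_min s0 tau0 ge_min lexx orbT.
apply/within_continuousP => t; rewrite /= in_itv/= andbT => t0 e e0.
have [d d0 xd] := (within_continuousP _ _).1 xc _ (min_tau t t0) e e0.
exists d => // s; rewrite /= in_itv/= andbT => s0 st.
apply: xd; first exact: min_tau.
apply: le_lt_trans st; rewrite /Num.min.
by case: ltP => ?; case: ltP => ?; rewrite ?lexx// ler_norml; apply/andP; split;
  have := ler_norm (s - t); have := ler_norm (t - s); rewrite (distrC t); lra.
Qed.

Definition mild_map (x0 : X) (x : R -> X) (t : R) : X :=
  T t x0 + input_map j T1 B2 t (stopped_input x) + input_map j T1 B t u.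

(** Injectivity of [j] turns the equation in the extrapolation space into a fixed-point equation in
    [X]; stopping at [tau] changes nothing on [0, t] for [t <= tau]. *)
Lemma mild_solutionP x0 x : mild_solution j T T1 B B2 f x0 u tau x <->
  {within `[0, tau], continuous x} /\
  forall t, 0 <= t <= tau -> mild_map x0 x t = x t.
Proof.
have stopE t : 0 <= t <= tau ->
    {in `[0, t], stopped_input x =1 (fun s => f (x s) (u s))}.
  move=> /andP[_ tt] s; rewrite in_itv/= => /andP[_ st].
  by rewrite /stopped_input min_l// (le_trans st).
split=> -[xc xE]; split => // t tt; have /andP[t0 ttau] := tt.
  have [y2 [y1 [c2 c1 E]]] := xE t tt.
  have {}c2 : is_convolution T1 B2 t (stopped_input x) y2.
    by apply: eq_is_convolution c2 => s /(stopE _ tt) ->.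
  apply: jinj; rewrite E /mild_map !raddfD /=.
  rewrite (is_convolution_unique c2 (input_mapP jinj hh2 t0 _)); last first.
    exact: Linfty_loc_stopped_input.
  by rewrite (is_convolution_unique c1 (input_mapP jinj hh t0 (Linfty_Linfty_loc lu))).
exists (j (input_map j T1 B2 t (stopped_input x))), (j (input_map j T1 B t u)).
split; last by rewrite -xE// /mild_map !raddfD.
  apply: eq_is_convolution (stopE _ tt) _.
  by apply: (input_mapP jinj hh2) => //; exact: Linfty_loc_stopped_input.
by apply: (input_mapP jinj hh) => //; exact: Linfty_Linfty_loc.
Qed.

Lemma mild_solution_unique x0 (x y : R -> X) :
  mild_solution j T T1 B B2 f x0 u tau x ->
  mild_solution j T T1 B B2 f x0 u tau y ->
  forall t, 0 <= t <= tau -> x t = y t.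
Proof.
move=> /mild_solutionP[xc xE] /mild_solutionP[yc yE].
have bounded_on (z : R -> X) : {within `[0, tau], continuous z} ->
    exists2 C : R, 0 <= C & forall t, 0 <= t <= tau -> `|z t| <= C.
  move=> zc; have := continuous_compact zc (@segment_compact R 0 tau).
  move=> /compact_bounded[C [_ zC]]; exists (Num.max 0 C + 1).
    by rewrite addr_ge0// le_max lexx.
  move=> t tt; apply: zC; first by rewrite ltr_pwDr// le_max lexx orbT.
  by exists t => //=; rewrite in_itv.
have [Cx Cx0 xC] := bounded_on x xc; have [Cy Cy0 yC] := bounded_on y yc.
have [K uK] := lu.2.
(* [C] exceeds both solutions and the input, so a single Lipschitz constant serves along both
   trajectories, wherever they go. *)
pose C := Cx + Cy + Num.max 0 K + 1.
have [C0 CxC CyC KC] : [/\ 0 < C, Cx < C, Cy < C & K < C].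
  have : 0 <= Num.max 0 K by rewrite le_max lexx.
  have : K <= Num.max 0 K by rewrite le_max lexx orbT.
  by rewrite /C; split; lra.
have [L L0 fL] := hLip C0.
have lg : Linfty_loc (stopped_input x \- stopped_input y).
  by apply: Linfty_locB; exact: Linfty_loc_stopped_input.
set g := stopped_input x \- stopped_input y in lg.
have dE t : 0 <= t <= tau -> x t - y t = input_map j T1 B2 t g.
  move=> tt; have /andP[t0 _] := tt.
  rewrite -xE// -yE// /mild_map (input_mapB jinj hh2)//;
    do ?exact: Linfty_loc_stopped_input.
  by rewrite opprD addrACA subrr addr0 opprD addrACA subrr add0r.
have gE : {ae mu, forall s, 0 <= s <= tau -> `|g s| <= L * `|x s - y s|}.
  apply: ae_mono uK => s us st; have /andP[s0 stau] := st.
  rewrite /g /stopped_input /= min_l//; apply: fL.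
  - exact: le_lt_trans (yC s st) CyC.
  - exact: le_lt_trans (xC s st) CxC.
  - by apply: le_lt_trans KC; apply: us; rewrite /= in_itv/= s0.
have L2 : 0 < (2 * L)^-1 by rewrite invr_gt0 mulr_gt0.
have [eta eta0 etah] := zero_class_small h2_zero L2.
(* Induction over intervals of length [eta], on which [h2] times [L] is at most 1/2: any bound for
   the difference up to the end of the new interval can be halved, starting from [Cx + Cy]. *)
have step k t : 0 <= t <= tau -> t <= eta *+ k -> x t - y t = 0.
  elim: k t => [|k IH] t tt.
    have /andP[t0 _] := tt; rewrite mulr0n => t0'.
    have -> : t = 0 by apply/eqP; rewrite eq_le t0' t0.
    by rewrite dE ?lexx ?tau0//; exact: input_map0.
  move=> tk; have [tk'|kt] := leP t (eta *+ k); first exact: IH.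
  have k0 : 0 <= eta *+ k by rewrite mulrn_wge0// ltW.
  have half (K' : R) : 0 <= K' -> 
      (forall s, 0 <= s <= tau -> s <= eta *+ k.+1 -> `|x s - y s| <= K') ->
      forall s, 0 <= s <= tau -> s <= eta *+ k.+1 -> `|x s - y s| <= K' / 2.
    move=> K'0 xyK s st sk; have [sk'|ks] := leP s (eta *+ k).
      by rewrite IH// normr0 divr_ge0.
    have /andP[s0 stau] := st.
    have kstau : eta *+ k <= tau by rewrite (le_trans (ltW ks)).
    have sk0 : 0 < s - eta *+ k by rewrite subr_gt0.
    (* The cocycle term carried over from time [eta *+ k] is the image of the difference there,
       which vanishes by induction. *)
    have -> : x s - y s = input_map j T1 B2 (s - eta *+ k) (g \o shiftr (eta *+ k)).
      rewrite dE// -{1}(subrKC (eta *+ k) s).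
      rewrite (input_map_cocycle jinj hT1 hh2 k0 (ltW sk0) lg).
      by rewrite -dE ?k0// IH ?k0// raddf0 add0r.
    have hk : h2 (s - eta *+ k) <= (2 * L)^-1.
      by apply/ltW/etah => //; move: sk; rewrite mulrS; lra.
    apply: (@le_trans _ _ (h2 (s - eta *+ k) * (L * K'))).
      apply: (input_map_leM jinj hh2) => //; first by rewrite mulr_ge0// ltW.
        exact: Linfty_loc_shiftr.
      apply: ae_mono (ae_shiftr (eta *+ k) gE) => s' gs'.
      rewrite /= in_itv/= => /andP[s'0 s's].
      have s'1 : 0 <= shiftr (eta *+ k) s' by rewrite addr_ge0.
      have s'2 : shiftr (eta *+ k) s' <= s by rewrite /shiftr; lra.
      have s't : 0 <= shiftr (eta *+ k) s' <= tau by rewrite s'1 (le_trans s'2).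
      apply: le_trans (gs' s't) _; apply: ler_wpM2l; first exact: ltW.
      by apply: xyK => //; apply: le_trans sk.
    apply: le_trans (ler_wpM2r _ hk) _; first by rewrite mulr_ge0// ltW.
    by rewrite invfM -mulrA mulKf ?gt_eqF// mulrC.
  apply/eqP; rewrite -normr_le0; apply: (@le_half_powers _ _ (Cx + Cy)) => n.
  suff : forall s, 0 <= s <= tau -> s <= eta *+ k.+1 ->
      `|x s - y s| <= (Cx + Cy) * 2^-1 ^+ n by apply.
  elim: n => [|n IHn] s st sk.
    rewrite expr0 mulr1; apply: le_trans (ler_normB _ _) _.
    by apply: lerD; [exact: xC|exact: yC].
  rewrite exprSr mulrA; apply: half => //.
  by rewrite mulr_ge0 ?addr_ge0// exprn_ge0.
move=> t tt; apply/eqP; rewrite -subr_eq0; apply/eqP.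
apply: (step (Num.truncn (tau / eta)).+1 t tt).
have /andP[_ ttau] := tt; apply: le_trans ttau _.
rewrite -mulr_natl -ler_pdivrMr//; apply: ltW; exact: truncnS_gt.
Qed.

End mild_solution.

(** * Local existence *)

Lemma expR_right_lt {R : realType} (lambda e : R) : 0 < e ->
  exists2 d : R, 0 < d & expR (lambda * d) < 1 + e.
Proof.
move=> e0.
have : expR (lambda * t) @[t --> 0^'+] --> expR (lambda * 0).
  apply: cvg_at_right_filter.
  by apply: continuous_comp; [exact: mulrl_continuous|exact: continuous_expR].
rewrite mulr0 expR0 => /cvgrPdist_lt /(_ e e0) /near_right0P[d d0 dP].
exists d => //; have := dP d d0 (lexx d); rewrite ltr_distlC => /andP[_]; lra.
Qed.

Theorem theorem3p7 (R : realType) (X U V : completeNormedModType R)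
    (* A generates T on X *)
    (D : set X) (A : X -> X) (T : R -> {linear X -> X})
    (hT : C0_semigroup T) (hA : generates D A T)
    (* X_{-1} and T_{-1} *)
    (Xm1 : completeNormedModType R) (j : {linear X -> Xm1})
    (hXm1 : is_extrapolation_space D A j)
    (Tm1 : R -> {linear Xm1 -> Xm1}) (hTm1 : is_extension j T Tm1)
    (B : {linear U -> Xm1}) (hBc : continuous B)
    (B2 : {linear V -> Xm1}) (hB2c : continuous B2)
    (f : X -> U -> V)
    (* (a) *)
    (hB : infty_admissible j Tm1 B)
    (hPhi : input_map_continuous j Tm1 B)
    (* (b) *)
    (hB2 : zero_class_infty_admissible j Tm1 B2)
    (hf : forall (u : R -> U) (x : R -> X), Linfty u ->
       {within `[0, +oo[, continuous x} ->
       Linfty_loc (fun s => f (x s) (u s)))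
    (* (c) *)
    (hLip : forall C : R, 0 < C -> exists2 L : R, 0 < L &
       forall (x y : X) (v : U), `|x| < C -> `|y| < C -> `|v| < C ->
         `|f y v - f x v| <= L * `|y - x|)
    (hfc : forall x : X, continuous (f x))
    (hf0 : exists (sigma : R -> R) (c : R),
       [/\ class_Kinfty sigma, 0 < c &
           forall v : U, `|f 0 v| <= sigma `|v| + c])
    (M lambda : R) (hM : 1 <= M) (hlambda : 0 < lambda)
    (hMT : forall t : R, 0 <= t ->
       (op_norm (T t) <= (M * expR (lambda * t))%:E)%E)
    (h : R -> R) (hh : admissibility_constants j Tm1 B h)
    (h0 : R) (hh0 : h t @[t --> 0^'+] --> h0)
    (Q : set X) (hQ : compact Q) (r : R) (hr : 0 < r)
    (S : set U) (hS : bounded_set S) (delta : R) (hdelta : 0 < delta) :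
  exists2 t1 : R, 0 < t1 &
    forall (w x0 : X) (u : R -> U), Q w -> ball w r x0 -> Linfty u ->
      {ae @lebesgue_measure R, forall t : R, 0 <= t -> S (u t)} ->
      exists phi : R -> X,
        [/\ mild_solution j T Tm1 B B2 f x0 u t1 phi,
            forall psi : R -> X, mild_solution j T Tm1 B B2 f x0 u t1 psi ->
              forall t : R, 0 <= t <= t1 -> psi t = phi t &
            forall t : R, 0 <= t <= t1 ->
              ball w (M * r + h0 * Linfty_norm `[0, t1] u + delta) (phi t)].
Proof.
have jinj : injective j := extrapolation_inj hA hXm1.
have [h2 [hh2 h2_zero]] := hB2.
have [sigma [c [[_ sigma0 sigma_incr _] c0 f0]]] := hf0.
have [q q0 Qq] : exists2 q : R, 0 <= q & forall w, Q w -> `|w| <= q.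
  have [q [_ Qq]] := compact_bounded hQ.
  exists (Num.max 0 q + 1); first by rewrite addr_ge0// le_max lexx.
  by move=> w; apply: Qq; rewrite ltr_pwDr// le_max lexx orbT.
have [K K0 SK] : exists2 K : R, 0 <= K & forall v, S v -> `|v| <= K.
  have [K [_ SK]] := hS.
  exists (Num.max 0 K + 1); first by rewrite addr_ge0// le_max lexx.
  by move=> v; apply: SK; rewrite ltr_pwDr// le_max lexx orbT.
have h_ge t : 0 < t -> 0 < h t by case: hh => h_pos _ _; exact: h_pos.
have h0_ge0 : 0 <= h0.
  apply: (@closed_cvg _ _ _ _ h (fun y => 0 <= y)) hh0; first exact: closed_ge.
  by near=> t; apply/ltW/h_ge; near: t; exact: nbhs_right_gt.
have M0 : 0 < M by exact: lt_le_trans hM.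
have hK0 : 0 <= h0 * K by rewrite mulr_ge0.
have Mr0 : 0 < M * r by rewrite mulr_gt0.
(* The iteration ball uses [K], a bound for all inputs in [S], since [t1] must not depend on [u].
   The sharper radius with the norm of [u] is recovered in [Fball]. *)
pose rho := M * r + h0 * K + delta.
pose C := q + rho + K + 1.
have [rho0 C0 qrhoC KC] : [/\ 0 < rho, 0 < C, q + rho < C & K < C].
  by rewrite /C /rho; split; lra.
have [L L0 fL] := hLip C C0.
(* Bound for [f]: growth of [f 0] on inputs bounded by [K], plus the Lipschitz variation from 0
   inside the ball of radius [C]. *)
pose G := sigma K + c + L * C.
have sigma_le s : 0 <= s -> s <= K -> sigma s <= sigma K.
  by move=> s0; rewrite le_eqVlt => /predU1P[->//|/(sigma_incr _ _ s0)/ltW].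
have sigmaK : 0 <= sigma K by rewrite -sigma0; exact: sigma_le.
have LC0 : 0 < L * C by rewrite mulr_gt0.
have G0 : 0 < G by rewrite /G; lra.
have fG x v : `|x| < C -> `|v| <= K -> `|f x v| <= G.
  move=> xC vK; rewrite -(subrK (f 0 v) (f x v)).
  apply: le_trans (ler_normD _ _) _; rewrite /G addrC; apply: lerD.
    by apply: le_trans (f0 v) _; rewrite lerD2r; exact: sigma_le.
  apply: le_trans (fL 0 x v _ _ _) _ => //; first by rewrite normr0.
    exact: le_lt_trans KC.
  by rewrite subr0 ler_pM2l// ltW.
(* The margin [delta] is shared by four errors: growth of the semigroup on x0 - w ([ta]), drift of
   [w] ([tb]), the nonlinear term ([tc]), and the excess of [h t] over [h0] ([te]). The time [td]
   makes the map contract by 1/2. *)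
have d4 : 0 < delta / 4 by rewrite divr_gt0.
have [ta ta0 taP] := expR_right_lt lambda (divr_gt0 d4 Mr0).
have [tb tb0 tbP] := semigroup_compact_cvg hT hM hlambda hMT hQ d4.
have [tc tc0 tcP] := zero_class_small h2_zero (divr_gt0 d4 G0).
have L2 : 0 < (2 * L)^-1 by rewrite invr_gt0 mulr_gt0.
have [td td0 tdP] := zero_class_small h2_zero L2.
have K1 : 0 < K + 1 by rewrite ltr_wpDl.
have [te te0 teP] : exists2 d : R, 0 < d &
    forall t, 0 < t -> t <= d -> h t <= h0 + delta / 4 / (K + 1).
  apply: near_right0P; move/cvgrPdist_lt : hh0 => /(_ _ (divr_gt0 d4 K1)).
  by apply: filterS => t; rewrite ltr_distlC => /andP[_ /ltW].
have [t1 t10 [t1a t1b t1c t1d t1e]] : exists2 t1 : R, 0 < t1 &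
    [/\ t1 <= ta, t1 <= tb, t1 <= tc, t1 <= td & t1 <= te].
  exists (Num.min ta (Num.min tb (Num.min tc (Num.min td te)))).
    by rewrite !lt_min ta0 tb0 tc0 td0.
  by split; rewrite !ge_min lexx ?orbT.
exists t1 => // w x0 u Qw; rewrite -ball_normE /= => wx0 lu uS.
have lu' := Linfty_Linfty_loc lu.
set N := Linfty_norm `[0, t1] u.
have uK : {ae @lebesgue_measure R, forall s, `[0, t1]%classic s -> `|u s| <= K}.
  apply: ae_mono uS => s us; rewrite /= in_itv/= => /andP[s0 _].
  by apply: SK; exact: us.
have uN : {ae @lebesgue_measure R, forall s, `[0, t1]%classic s -> `|u s| <= N}.
  by apply: ae_le_Linfty_norm; exists K.
have N0 : 0 <= N by exact: Linfty_norm_ge0.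
have NK : N <= K by exact: Linfty_norm_le.
have N4 : h0 * N + delta / 4 / (K + 1) * N <= h0 * N + delta / 4.
  rewrite lerD2l -(mulrA (delta / 4)) -[leRHS]mulr1 ler_pM2l// mulrC ler_pdivrMr// mul1r.
  by rewrite (le_trans NK)// lerDl.
have hN : h0 * N <= h0 * K by rewrite ler_wpM2l.
pose P (x : R -> X) := {within `[0, t1], continuous x} /\
  forall t, `[0, t1]%classic t -> `|x t - w| <= rho.
pose g := stopped_input f u t1.
have gP x : P x -> Linfty_loc (g x).
  by move=> [xc _]; apply: (Linfty_loc_stopped_input hf lu (ltW t10)).
have xC x s : P x -> `[0, t1]%classic s -> `|x s| < C.
  move=> [_ xw] /xw xsw; rewrite -(subrK w (x s)).
  apply: le_lt_trans (ler_normD _ _) _; apply: le_lt_trans qrhoC.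
  by rewrite addrC; apply: lerD => //; exact: Qq.
have in_seg s : 0 <= s -> s <= t1 -> `[0, t1]%classic s.
  by move=> s0 st; rewrite /= in_itv/= s0.
have conv_le (x : R -> X) t : P x -> `[0, t1]%classic t ->
    `|input_map j Tm1 B2 t (g x)| <= delta / 4.
  move=> Px; rewrite /= in_itv/= => /andP[]; rewrite le_eqVlt => /predU1P[<- _|t0 tt1].
    by rewrite input_map0// normr0 ltW.
  apply: (@le_trans _ _ (h2 t * G)).
    apply: (input_map_leM jinj hh2) => //; [exact: ltW|exact: gP|].
    apply: ae_mono uK => s us; rewrite /= in_itv/= => /andP[s0 st].
    have s1 := le_trans st tt1.
    rewrite /g /stopped_input min_l//; apply: fG; last exact/us/in_seg.
    by apply: xC => //; exact: in_seg.
  by rewrite -ler_pdivlMr//; apply/ltW/tcP => //; exact: le_trans t1c.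
have input_le t : `[0, t1]%classic t ->
    `|input_map j Tm1 B t u| <= h0 * N + delta / 4.
  rewrite /= in_itv/= => /andP[]; rewrite le_eqVlt => /predU1P[<- _|t0 tt1].
    by rewrite input_map0// normr0 addr_ge0 ?mulr_ge0// ltW.
  apply: (@le_trans _ _ (h t * N)).
    apply: (input_map_leM jinj hh) => //.
    apply: ae_mono uN => s us; rewrite /= in_itv/= => /andP[s0 st].
    by apply: us; apply: in_seg => //; exact: le_trans tt1.
  by apply: le_trans N4; rewrite -mulrDl ler_wpM2r//; apply: teP => //; exact: le_trans t1e.
(* The strict estimate of T(t)w - w is what places the solution in the open ball. *)
have free_lt t : `[0, t1]%classic t -> `|T t x0 - w| < M * r + delta / 4 + delta / 4.
  rewrite /= in_itv/= => /andP[t0 tt1].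
  have -> : T t x0 - w = T t (x0 - w) + (T t w - w) by rewrite raddfB /= addrA subrK.
  apply: le_lt_trans (ler_normD _ _) _; apply: ler_ltD; last first.
    by apply: tbP => //; exact: le_trans t1b.
  have := semigroup_le hM hlambda hMT (x0 - w) t0 (le_trans tt1 t1a).
  move=> /le_trans; apply; rewrite distrC.
  apply: (@le_trans _ _ (M * expR (lambda * ta) * r)).
    by rewrite ler_wpM2l ?mulr_ge0 ?expR_ge0 ?ltW.
  rewrite mulrAC; move: (ltW taP) => /(ler_wpM2l (ltW Mr0)) /le_trans; apply.
  by rewrite mulrDr mulr1 mulrCA mulfV ?gt_eqF// mulr1.
pose F := mild_map j T Tm1 B B2 f u t1 x0.
have Fball x t : P x -> `[0, t1]%classic t ->
    `|F x t - w| < M * r + h0 * N + delta.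
  move=> Px tt; rewrite /F /mild_map -/g addrAC (addrAC (T t x0)).
  apply: le_lt_trans (ler_normD _ _) _.
  apply: le_lt_trans (lerD (ler_normD _ _) (lexx _)) _.
  have := ltr_leD (ltr_leD (free_lt t tt) (conv_le x t Px tt)) (input_le t tt).
  by move=> /lt_le_trans; apply; clear; lra.
have FP x : P x -> P (F x).
  move=> Px; split; last first.
    by move=> t tt; apply/ltW/(lt_le_trans (Fball x t Px tt)); rewrite lerD2r lerD2l.
  apply/within_continuousP => t; rewrite /= in_itv/= => /andP[t0 tt1] e e0.
  have e3 : 0 < e / 3 by rewrite divr_gt0.
  have [d1 d10 d1P] := semigroup_cvg hT hM hlambda hMT x0 t0 e3.
  have [d2 d20 d2P] := input_map_cvg jinj hTm1 hh2 h2_zero hT hM hlambda hMT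
    (gP x Px) t0 e3.
  (* [B] is not assumed zero-class, so continuity in time of its input map comes from (a), with the
     input kept at [u]. *)
  have [d3 d30 d3P] := hPhi t u t0 lu (e / 3) e3.
  exists (Num.min d1 (Num.min d2 d3)); first by rewrite !lt_min d10 d20.
  move=> s; rewrite /= in_itv/= => /andP[s0 _]; rewrite !lt_min => /and3P[sd1 sd2 sd3].
  have := d1P s s0 sd1; have := d2P s s0 sd2.
  have : `|input_map j Tm1 B s u - input_map j Tm1 B t u| < e / 3.
    apply: d3P => //; rewrite Linfty_norm0// => z.
    by rewrite /= subrr.
  rewrite /F /mild_map -/g opprD addrACA opprD (addrACA (T s x0)) => a1 a2 a3.
  apply: le_lt_trans (ler_normD _ _) _.
  apply: le_lt_trans (lerD (ler_normD _ _) (lexx _)) _.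
  by have /lt_le_trans := ltrD (ltrD a3 a2) a1; apply; clear; lra.
have FK x y (k : R) : P x -> P y -> 0 <= k ->
    (forall t, `[0, t1]%classic t -> `|x t - y t| <= k) ->
    forall t, `[0, t1]%classic t -> `|F x t - F y t| <= k / 2.
  move=> Px Py k0 xyk t; rewrite /= in_itv/= => /andP[t0 tt1].
  rewrite /F /mild_map -/g opprD addrACA (subrr (input_map _ _ _ t u)) addr0.
  rewrite opprD addrACA (subrr (T t x0)) add0r.
  move: t0 tt1; rewrite le_eqVlt => /predU1P[<- _|t0 tt1].
    by rewrite !input_map0// subrr normr0 divr_ge0.
  rewrite -(input_mapB jinj hh2 (ltW t0) (gP x Px) (gP y Py)).
  apply: (@le_trans _ _ (h2 t * (L * k))).
    apply: (input_map_leM jinj hh2) => //; first by rewrite mulr_ge0// ltW.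
      by apply: Linfty_locB; exact: gP.
    apply: ae_mono uK => s us; rewrite /= in_itv/= => /andP[s0 st].
    have s1 := in_seg s s0 (le_trans st tt1).
    rewrite /g /stopped_input min_l ?(le_trans st)//.
    apply: le_trans (fL _ _ _ (xC y s Py s1) (xC x s Px s1) _) _.
      by apply: le_lt_trans KC; exact: us.
    by rewrite ler_pM2l//; exact: xyk.
  apply: (@le_trans _ _ ((2 * L)^-1 * (L * k))).
    apply: ler_wpM2r; first by rewrite mulr_ge0// ltW.
    by apply/ltW/tdP => //; exact: le_trans t1d.
  by rewrite invfM -mulrA mulKf ?gt_eqF// mulrC.
have [phi Pphi phiE] := contraction_fixed_point (ltW rho0) FP FK.
have phi_mild : mild_solution j T Tm1 B B2 f x0 u t1 phi.
  apply/(mild_solutionP T jinj hh hh2 hf lu (ltW t10)); split; first exact: Pphi.1.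
  by move=> t /andP[t0 tt1]; exact/phiE/in_seg.
exists phi; split => //.
  move=> psi psi_mild.
  exact: (mild_solution_unique jinj hTm1 hh hh2 h2_zero hf hLip lu (ltW t10)
    psi_mild phi_mild).
move=> t /andP[t0 tt1]; rewrite distrC -phiE; last exact: in_seg.
by apply: Fball => //; exact: in_seg.
Unshelve. all: by end_near. Qed.
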